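(* Let $\lambda=1$ or $\lambda=-1$, and let a tetrahedron with vertices $v_1,v_2,v_3,v_4$ be given in $\mathbf{S}^3$ (if $\lambda=1$) or in $\mathbf{H}^3$ (if $\lambda=-1$). Let $x_{ij}=x_{ji}$ be the length of the edge $v_iv_j$ and let $a_{ij}=a_{ji}$ be the dihedral angle at the edge $v_iv_j$. Consider each $x_{ij}$ as a function of the six dihedral angles $a_{12},a_{13},a_{14},a_{23},a_{24},a_{34}$, and for any two edges $\{i,j\}$ and $\{r,s\}$ define $$R^{ij}_{rs}=\frac{1}{\sin(\sqrt{\lambda}\,x_{ij})\,\sin(\sqrt{\lambda}\,x_{rs})}\,\frac{\partial x_{ij}}{\partial a_{rs}}.$$ Then the following identities hold, where the indices $i,j,k,l$ are pairwise distinct, i.e. $\{i,j,k,l\}=\{1,2,3,4\}$: (i) $R^{ij}_{rs}=R^{rs}_{ij}$ for all edges $\{i,j\}$, $\{r,s\}$. (ii) $R^{ij}_{kl}=R^{ik}_{jl}=R^{il}_{jk}$. (iii) $R^{ij}_{ik}=R^{ij}_{kl}\cos(\sqrt{\lambda}\,x_{il})$. (iv) $R^{ij}_{ij}=R^{ij}_{kl}\,w_{ij}$, where $$w_{ij}=\frac{-c_{ij}c_{ik}c_{il}-c_{ji}c_{jk}c_{jl}+c_{ik}c_{jl}+c_{il}c_{jk}}{\sin^2(\sqrt{\lambda}\,x_{ij})},\qquad c_{rs}=\cos(\sqrt{\lambda}\,x_{rs}).$$ (v) $R^{ij}_{rs}=R^{i'j'}_{r's'}$ whenever $\{i,j\}\neq\{r,s\}$,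 where for a two-element subset $\{a,b\}\subset\{1,2,3,4\}$ the set $\{a',b'\}$ denotes the complement $\{1,2,3,4\}\setminus\{a,b\}$.
   Context: $\mathbf{S}^3$ and $\mathbf{H}^3$ denote the 3-dimensional spherical and hyperbolic spaces, of constant curvature $\lambda=1$ and $\lambda=-1$ respectively. A tetrahedron means a (non-degenerate) geodesic tetrahedron with its four vertices in the space. The dihedral angle at an edge is the interior angle between the two faces meeting along that edge. For $\lambda=\pm1$ a tetrahedron is determined up to isometry by its six dihedral angles, so each edge length is a function of the six dihedral angles, and $\partial x_{ij}/\partial a_{rs}$ is the partial derivative with respect to $a_{rs}$ with the other five angles held fixed; the $6\times 6$ matrix $[\partial x_{ij}/\partial a_{rs}]$ is the inverse of the matrix $[\partial a_{ij}/\partial x_{rs}]$ obtained by viewing the dihedral angles as functions of the six edge lengths. For $\lambda=-1$, $\sqrt{\lambda}=\sqrt{-1}$, so that $\sin(\sqrt{-1}\,x)=\sqrt{-1}\,\sinh(x)$ and $\cos(\sqrt{-1}\,x)=\cosh(x)$. All quantities are indexed by unordered pairs (edges), so $R^{ij}_{rs}=R^{ji}_{rs}=R^{ij}_{sr}$ and $c_{rs}=c_{sr}$. *)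

(* Defs.v *)
From HB Require Import structures.
From mathcomp Require Import all_boot all_order all_algebra.
From mathcomp Require Import complex.
From mathcomp Require Import all_classical all_reals all_analysis.

Set Implicit Arguments.
Unset Strict Implicit.
Unset Printing Implicit Defensive.

Import Order.TTheory GRing.Theory Num.Theory.
Import numFieldNormedType.Exports.

Local Open Scope ring_scope.
Local Open Scope complex_scope.

Section RealHyperbolic.
Variable R : realType.
Implicit Type t : R.

Definition cosh t : R := (expR t + expR (- t)) / 2.
Definition sinh t : R := (expR t - expR (- t)) / 2.

(* The inverse of cosh on [0, +oo[; only used at arguments >= 1. *)
Definition acosh t : R := ln (t + Num.sqrt (t ^+ 2 - 1)).

End RealHyperbolic.

Section ComplexTrigo.
Variable R : realType.
Implicit Types (z : R[i]) (lam t : R).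

(* The entire functions sin and cos, split as sin (a + ib) and cos (a + ib). *)
Definition csin z : R[i] :=
  (sin (complex.Re z) * cosh (complex.Im z))
    +i* (cos (complex.Re z) * sinh (complex.Im z)).
Definition ccos z : R[i] :=
  (cos (complex.Re z) * cosh (complex.Im z))
    -i* (sin (complex.Re z) * sinh (complex.Im z)).

(* sin (sqrt lam * t) and cos (sqrt lam * t), where sqrtC (-1) = 'i. *)
Definition lsin lam t : R[i] := csin (sqrtC lam%:C * t%:C).
Definition lcos lam t : R[i] := ccos (sqrtC lam%:C * t%:C).

End ComplexTrigo.

Section Geometry.
Variables (R : realType) (lam : R).
Implicit Types (p q u w : 'rV[R]_4) (V : 'M[R]_4) (i j k l : 'I_4).

(* The bilinear form lam x0 y0 + x1 y1 + x2 y2 + x3 y3: Euclidean for lam = 1,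
   Lorentzian for lam = -1. *)
Definition bform u w : R :=
  \sum_(i < 4) (if i == 0 then lam else 1) * u 0 i * w 0 i.

(* For lam = 1 the unit sphere S^3; for lam = -1 the upper sheet of the
   hyperboloid <p, p> = -1, i.e. the hyperboloid model of H^3. *)
Definition in_space p : Prop := bform p p = lam /\ (lam = -1 -> 0 < p 0 0).

Definition gdist p q : R :=
  if lam == 1 then acos (bform p q) else acosh (- bform p q).

(* Row i of V is the vertex v_i.  Four points of the space span a
   non-degenerate tetrahedron iff they are linearly independent in R^4. *)
Definition tetrahedron V : Prop :=
  (forall i, in_space (row i V)) /\ row_free V.

Definition edge_length V i j : R := gdist (row i V) (row j V).

(* A positive multiple of the initial velocity at p of the geodesic from p
   to q: the orthogonal projection of q on the tangent space at p. *)
Definition direction p q : 'rV[R]_4 := q - (lam * bform p q) *: p.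

(* The component of w orthogonal to u. *)
Definition orth u w : 'rV[R]_4 := w - (bform u w / bform u u) *: u.

Definition vangle u w : R :=
  acos (bform u w / (Num.sqrt (bform u u) * Num.sqrt (bform w w))).

(* Interior dihedral angle at the edge v_i v_j of the faces v_i v_j v_k and
   v_i v_j v_l, measured in the tangent space at v_i: it is the angle between
   the vectors normal to the edge that point into these two faces. *)
Definition dihedral V i j k l : R :=
  let e m := direction (row i V) (row m V) in
  vangle (orth (e j) (e k)) (orth (e j) (e l)).

(* Families indexed by edges are functions of two indices; only their values
   at distinct indices matter. *)
Definition has_dihedral_angles V (a : 'I_4 -> 'I_4 -> R) : Prop :=
  forall i j k l, uniq [:: i; j; k; l] -> a i j = dihedral V i j k l.

(* Edge lengths as functions of the dihedral angles: the length of v_i v_j in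
   a tetrahedron with dihedral angles a, which is unique up to isometry
   (junk if there is none). *)
Definition length_of_angles (a : 'I_4 -> 'I_4 -> R) i j : R :=
  edge_length
    (xget 0 [set V | tetrahedron V /\ has_dihedral_angles V a]%classic) i j.

Definition set_angle (a : 'I_4 -> 'I_4 -> R) (r s : 'I_4) (t : R) :
    'I_4 -> 'I_4 -> R :=
  fun m n =>
    if ((m == r) && (n == s)) || ((m == s) && (n == r)) then t else a m n.

(* x_ij as a function of the single angle a_rs, the other five held fixed. *)
Definition length_along (a : 'I_4 -> 'I_4 -> R) (i j r s : 'I_4) : R -> R :=
  fun t => length_of_angles (set_angle a r s t) i j.

Definition dlength (a : 'I_4 -> 'I_4 -> R) (i j r s : 'I_4) : R :=
  derive1 (length_along a i j r s) (a r s).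

Definition Rcoef V (a : 'I_4 -> 'I_4 -> R) (i j r s : 'I_4) : R[i] :=
  (lsin lam (edge_length V i j) * lsin lam (edge_length V r s))^-1
  * (dlength a i j r s)%:C.

Definition ccoef V (r s : 'I_4) : R[i] := lcos lam (edge_length V r s).

Definition wcoef V i j k l : R[i] :=
  let c := ccoef V in
  (- (c i j * c i k * c i l) - c j i * c j k * c j l
   + c i k * c j l + c i l * c j k)
  / lsin lam (edge_length V i j) ^+ 2.

End Geometry.

(* Main.v *)
Require Import Defs.
From HB Require Import structures.
From mathcomp Require Import all_boot all_order all_algebra.
From mathcomp Require Import complex.
From mathcomp Require Import all_classical all_reals all_analysis.
From mathcomp Require Import ring lra.

Set Implicit Arguments.
Unset Strict Implicit.
Unset Printing Implicit Defensive.

Import Order.TTheory GRing.Theory Num.Theory.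
Import numFieldNormedType.Exports.

Local Open Scope ring_scope.

(** Two symmetric 4 x 4 matrices with unit diagonal describe a tetrahedron.
The first, c, is lam times the Gram matrix of the vertices, so that its entry
c_ij = lam <v_i, v_j> is cos (sqrt lam x_ij).  The second, h, is the Gram matrix
of the outer unit normals of the faces: h_kl is minus the cosine of the
dihedral angle at the edge opposite to v_k v_l.  Two steps of Gram-Schmidt at
a vertex show that h is the adjugate of c, normalized to have unit diagonal
(cos_angle_dual).  The adjugate of an adjugate being a positive multiple of the
matrix it started from, c is in turn the normalized adjugate of h (dual_dual):
the lengths are explicit functions of the angles, whatever the tetrahedron
that realizes them.

Differentiating a length in one angle also requires that all nearby families
of angles be realized.  The sign conditions on minors of h that hold for a
tetrahedron are open conditions, and they are sufficient: they pass to the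
normalized adjugate, which a Cholesky decomposition then realizes as the Gram
matrix of four points (realize_gram, realize_angles, near_realizable).

The derivative of c in an entry h_mn comes from the derivative of an inverse
matrix, d(H^-1) = - H^-1 (dH) H^-1, which for the adjugate A and the
determinant D of h reads
  D dA_ij = (2 A_mn A_ij - A_im A_nj - A_in A_mj) dh_mn.
The normalization turns A into c.  The factor dh_mn/da is the sine of the
angle.  Its square 1 - h_mn^2 is a principal minor of h, so that by Jacobi's
identity on the minors of an adjugate this sine is proportional to the one,
circular or hyperbolic, of the length of the same edge.  The remaining factors
collect into rho = 1 / sqrt (lam det c), and with S_ij = sqrt (lam (1 - c_ij^2))
the partial derivatives (partials) are
  dx_ij/da_kl = rho lam S_ij S_kl,
  dx_ij/da_ik = rho lam S_ij S_ik c_il,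
  dx_ij/da_ij = rho w_ij (1 - c_ij^2).
As sin (sqrt lam x_ij) = sqrt lam S_ij, the coefficients R are rho, rho c_il
and rho w_ij.  Since rho is invariant under permutations of the vertices, the
identities can be read off from these three values. *)

(** * Minors of a symmetric matrix with unit diagonal *)

Section Cofactors.
Variables (F : fieldType) (I : Type).
Implicit Types (f : I -> I -> F) (i j k l : I).

(** The principal minor on i, j, k. *)
Definition tri f i j k : F :=
  1 + 2 * f i j * f i k * f j k - f i j ^+ 2 - f i k ^+ 2 - f j k ^+ 2.

(** The cofactor of the entry (k, l) of the matrix on i, j, k, l, developed by
Sylvester's identity from the minors that contain the entry (i, i) = 1. *)
Definition cof f i j k l : F :=
  (f j k - f i j * f i k) * (f j l - f i j * f i l)
  - (f k l - f i k * f i l) * (1 - f i j ^+ 2).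

Definition det4 f i j k l : F :=
  1 - f i j ^+ 2 - f i k ^+ 2 - f i l ^+ 2 - f j k ^+ 2 - f j l ^+ 2
  - f k l ^+ 2
  + 2 * (f i j * f i k * f j k + f i j * f i l * f j l
         + f i k * f i l * f k l + f j k * f j l * f k l)
  + (f i j * f k l) ^+ 2 + (f i k * f j l) ^+ 2 + (f i l * f j k) ^+ 2
  - 2 * (f i j * f k l * f i k * f j l + f i j * f k l * f i l * f j k
         + f i k * f j l * f i l * f j k).

Variables (f : I -> I -> F).
Hypothesis fC : forall i j, f i j = f j i.

Lemma triC12 i j k : tri f i j k = tri f j i k.
Proof. by rewrite /tri (fC j i); ring. Qed.

Lemma triC23 i j k : tri f i j k = tri f i k j.
Proof. by rewrite /tri (fC k j); ring. Qed.

Lemma tri_rot i j k : tri f i j k = tri f k i j.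
Proof. by rewrite triC23 triC12. Qed.

Lemma cofC12 i j k l : cof f i j k l = cof f j i k l.
Proof. by rewrite /cof (fC j i); ring. Qed.

Lemma cofC34 i j k l : cof f i j k l = cof f i j l k.
Proof. by rewrite /cof (fC l k); ring. Qed.

Lemma det4C12 i j k l : det4 f i j k l = det4 f j i k l.
Proof. by rewrite /det4 (fC j i); ring. Qed.

Lemma det4C23 i j k l : det4 f i j k l = det4 f i k j l.
Proof. by rewrite /det4 (fC k j); ring. Qed.

Lemma det4C34 i j k l : det4 f i j k l = det4 f i j l k.
Proof. by rewrite /det4 (fC l k); ring. Qed.

Lemma det4C13_24 i j k l : det4 f i j k l = det4 f k l i j.
Proof. by rewrite det4C23 det4C12 det4C34 det4C23. Qed.

(** Jacobi's identity: a minor of size 2 of the adjugate is the determinant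
times the complementary minor. *)
Lemma jacobi i j k l :
  tri f i j k * tri f i j l - cof f i j k l ^+ 2
  = det4 f i j k l * (1 - f i j ^+ 2).
Proof. by rewrite /tri /cof /det4; ring. Qed.

(** The adjugate of f has the diagonal entries tri f j k l, tri f i k l,
tri f i j l and tri f i j k, and cof f k l i j, etc., off the diagonal.  In
these terms the next three lemmas are the identities adj (adj f) = (det f)^2 f,
on and off the diagonal, and det (adj f) = (det f)^3.  The cofactor at (k, l)
comes multiplied by the pivot tri f j k l, as Sylvester's identity prescribes
for a matrix whose diagonal entries need not be 1. *)
Lemma adj_tri i j k l :
  tri f j k l * tri f i k l * tri f i j l
  + 2 * cof f k l i j * cof f j l i k * cof f i l j k
  - tri f i j l * cof f k l i j ^+ 2 - tri f i k l * cof f j l i k ^+ 2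
  - tri f j k l * cof f i l j k ^+ 2
  = det4 f i j k l ^+ 2.
Proof.
rewrite /tri /cof /det4 (fC k j) (fC l j) (fC l i) (fC l k) (fC k i) (fC j i).
by ring.
Qed.

Lemma adj_cof i j k l :
  (cof f i l j k * tri f j k l - cof f k l i j * cof f j l i k)
    * (cof f i k j l * tri f j k l - cof f k l i j * cof f j k i l)
  - (cof f i j k l * tri f j k l - cof f j l i k * cof f j k i l)
    * (tri f j k l * tri f i k l - cof f k l i j ^+ 2)
  = tri f j k l * (det4 f i j k l ^+ 2 * f k l).
Proof.
rewrite /tri /cof /det4 (fC k j) (fC l j) (fC l i) (fC l k) (fC k i) (fC j i).
by ring.
Qed.

Lemma adj_det4 i j k l :
  tri f j k l * tri f i k l * tri f i j l * tri f i j k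
  - cof f k l i j ^+ 2 * tri f i j l * tri f i j k
  - cof f j l i k ^+ 2 * tri f i k l * tri f i j k
  - cof f j k i l ^+ 2 * tri f i k l * tri f i j l
  - cof f i l j k ^+ 2 * tri f j k l * tri f i j k
  - cof f i k j l ^+ 2 * tri f j k l * tri f i j l
  - cof f i j k l ^+ 2 * tri f j k l * tri f i k l
  + 2 * (cof f k l i j * cof f j l i k * cof f i l j k * tri f i j k
         + cof f k l i j * cof f j k i l * cof f i k j l * tri f i j l
         + cof f j l i k * cof f j k i l * cof f i j k l * tri f i k l
         + cof f i l j k * cof f i k j l * cof f i j k l * tri f j k l)
  + (cof f k l i j * cof f i j k l) ^+ 2 + (cof f j l i k * cof f i k j l) ^+ 2
  + (cof f j k i l * cof f i l j k) ^+ 2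
  - 2 * (cof f k l i j * cof f i j k l * cof f j l i k * cof f i k j l
         + cof f k l i j * cof f i j k l * cof f j k i l * cof f i l j k
         + cof f j l i k * cof f i k j l * cof f j k i l * cof f i l j k)
  = det4 f i j k l ^+ 3.
Proof.
rewrite /tri /cof /det4 (fC k j) (fC l j) (fC l i) (fC l k) (fC k i) (fC j i).
by ring.
Qed.

(** dtri and dcof are the differentials of tri and cof at f, applied to d. *)
Definition dtri f d i j k : F :=
  2 * (d i j * f i k * f j k + f i j * d i k * f j k + f i j * f i k * d j k
       - f i j * d i j - f i k * d i k - f j k * d j k).

Definition dcof f d i j k l : F :=
  (d j k - d i j * f i k - f i j * d i k) * (f j l - f i j * f i l)
  + (f j k - f i j * f i k) * (d j l - d i j * f i l - f i j * d i l)
  - (d k l - d i k * f i l - f i k * d i l) * (1 - f i j ^+ 2)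
  + 2 * (f k l - f i k * f i l) * f i j * d i j.

Variable d : I -> I -> F.
Hypothesis dC : forall i j, d i j = d j i.

(** The derivative of an inverse matrix, stated for the adjugate A:
det f * dA_ij = tr (A d) A_ij - (A d A)_ij, here on the diagonal. *)
Lemma det4_dtri i j k l :
  det4 f i j k l * dtri f d j k l
  = 2 * ((cof f k l i j * tri f j k l - tri f j k l * cof f k l i j) * d i j
       + (cof f j l i k * tri f j k l - tri f j k l * cof f j l i k) * d i k
       + (cof f j k i l * tri f j k l - tri f j k l * cof f j k i l) * d i l
       + (cof f i l j k * tri f j k l - cof f k l i j * cof f j l i k) * d j k
       + (cof f i k j l * tri f j k l - cof f k l i j * cof f j k i l) * d j l
       + (cof f i j k l * tri f j k l - cof f j l i k * cof f j k i l) * d k l).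
Proof.
rewrite /dtri /tri /cof /det4.
rewrite (fC k j) (fC l j) (fC l i) (fC l k) (fC k i) (fC j i).
ring.
Qed.

Lemma det4_dcof i j k l :
  det4 f i j k l * dcof f d k l i j
  = (cof f k l i j ^+ 2 - tri f j k l * tri f i k l) * d i j
    + (cof f j l i k * cof f k l i j - tri f j k l * cof f i l j k) * d i k
    + (cof f j k i l * cof f k l i j - tri f j k l * cof f i k j l) * d i l
    + (cof f i l j k * cof f k l i j - cof f j l i k * tri f i k l) * d j k
    + (cof f i k j l * cof f k l i j - cof f j k i l * tri f i k l) * d j l
    + (2 * cof f i j k l * cof f k l i j - cof f j l i k * cof f i k j l
       - cof f j k i l * cof f i l j k) * d k l.
Proof.
rewrite /dcof /tri /cof /det4.
rewrite (fC k j) (fC l j) (fC l i) (fC l k) (fC k i) (fC j i).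
rewrite (dC k j) (dC l j) (dC l i) (dC k i).
ring.
Qed.

End Cofactors.

(** * The four vertices *)

Lemma ord4_cover (i j k l m : 'I_4) :
  uniq [:: i; j; k; l] -> m \in [:: i; j; k; l].
Proof.
move=> U; have [||_ ->] := @uniq_min_size _ [:: i; j; k; l] (enum 'I_4) U.
- by move=> x _; rewrite mem_enum.
- by rewrite -cardE card_ord.
- by rewrite mem_enum.
Qed.

Lemma ord4_complement (k l : 'I_4) :
  k != l -> exists i j, uniq [:: i; j; k; l].
Proof.
move=> kl; have /eqP/cards2P[i [j [ij E]]] : #|~: [set k; l]%SET| = 2%N.
  by rewrite cardsCs finset.setCK card_ord cards2 kl.
have := set21 i j; have := set22 i j; rewrite -E !inE !negb_or.
move=> /andP[jk jl] /andP[ik il].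
by exists i, j; rewrite /= !inE !negb_or ij ik il jk jl kl.
Qed.

Lemma uniq4_neq (i j k l : 'I_4) : uniq [:: i; j; k; l] -> i != j.
Proof. by rewrite /= !inE !negb_or => /andP[/andP[]]. Qed.

Lemma perm_eq_uniq (T : eqType) (s t : seq T) :
  uniq s -> perm_eq s t -> uniq t.
Proof. by move=> U /perm_uniq <-. Qed.

Ltac perm4 U := apply: (perm_eq_uniq U); apply/permP=> ? /=; ring.

Lemma ord4_complement_uniq (i j k l k' l' : 'I_4) :
  uniq [:: i; j; k; l] -> uniq [:: i; j; k'; l'] ->
  (k' = k /\ l' = l) \/ (k' = l /\ l' = k).
Proof.
move=> U U'; have /[!inE] := ord4_cover k' U; have /[!inE] := ord4_cover l' U.
move: U'; rewrite /= !inE !negb_or -!andbA.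
move=> /and5P[_ + + + /and3P[+ + _]].
rewrite !(eq_sym i) !(eq_sym j) => /negPf-> /negPf-> /negPf-> /negPf-> /=.
move=> kl /orP[]/eqP el /orP[]/eqP ek; rewrite el ek; [|by right|by left|].
  by rewrite el ek eqxx in kl.
by rewrite el ek eqxx in kl.
Qed.

(** * The normalized adjugate *)

(* The identities below hold with the minors as independent variables. *)
Ltac atomize_minors :=
  repeat match goal with
  | |- context [cof ?f ?a ?b ?c ?d] =>
    let x := fresh "m" in generalize (cof f a b c d) => x
  | |- context [det4 ?f ?a ?b ?c ?d] =>
    let x := fresh "m" in generalize (det4 f a b c d) => x
  end.

Section Dual.
Variable R : rcfType.
Implicit Types (f : 'I_4 -> 'I_4 -> R) (i j k l : 'I_4).

(** The matrix whose entry (k, l) is the value of F at the edge opposite to k l,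
completed by a unit diagonal. *)
Definition at_opposite (F : 'I_4 -> 'I_4 -> R) k l : R :=
  if [pick e : 'I_4 * 'I_4 | uniq [:: e.1; e.2; k; l]] is Some e
  then F e.1 e.2 else 1.

Lemma at_oppositeE (F : 'I_4 -> 'I_4 -> R) i j k l :
  (forall i j, F i j = F j i) -> uniq [:: i; j; k; l] ->
  at_opposite F k l = F i j.
Proof.
move=> FC U; rewrite /at_opposite.
case: pickP => [[i' j'] U'|/(_ (i, j))]; last by rewrite U.
have V : uniq [:: k; l; i; j] by perm4 U.
have V' : uniq [:: k; l; i'; j'] by perm4 U'.
by have [[-> ->]|[-> ->]] := ord4_complement_uniq V V'.
Qed.

Lemma at_opposite_diag F k : at_opposite F k k = 1.
Proof.
by rewrite /at_opposite; case: pickP => // e; rewrite /= !inE eqxx /= !andbF.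
Qed.

(** The adjugate of f, rescaled to have unit diagonal: up to sign, the Gram
matrix of the normalized dual basis. *)
Definition dual f k l : R :=
  at_opposite (fun i j =>
    cof f i j k l / (Num.sqrt (tri f i j k) * Num.sqrt (tri f i j l))) k l.

Definition symm f := forall i j, f i j = f j i.

(** The numerator of w_ij in terms of the matrix of cosines. *)
Definition wnum f i j k l : R :=
  f i k * f j l + f i l * f j k
  - f i j * (f i k * f i l + f j k * f j l).

Lemma dualE f i j k l : symm f -> uniq [:: i; j; k; l] ->
  dual f k l
  = cof f i j k l / (Num.sqrt (tri f i j k) * Num.sqrt (tri f i j l)).
Proof.
move=> fC U; rewrite /dual (at_oppositeE _ U) // => i' j'.
by rewrite cofC12 // !(triC12 fC i' j').
Qed.

Lemma dual_diag f k : dual f k k = 1. Proof. exact: at_opposite_diag. Qed.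

Lemma dualC f : symm f -> symm (dual f).
Proof.
move=> fC k l; have [->//|kl] := eqVneq k l.
have [i [j U]] := ord4_complement kl.
have U' : uniq [:: i; j; l; k] by perm4 U.
by rewrite (dualE fC U) (dualE fC U') cofC34 // (mulrC (Num.sqrt _)).
Qed.

Section Involution.
Variables (f : 'I_4 -> 'I_4 -> R).
Hypothesis fC : symm f.
Variables i j k l : 'I_4.
Hypothesis U : uniq [:: i; j; k; l].

Let si := Num.sqrt (tri f j k l).
Let sj := Num.sqrt (tri f i k l).
Let sk := Num.sqrt (tri f i j l).
Let sl := Num.sqrt (tri f i j k).

Lemma dual_entries :
  [/\ dual f i j = cof f k l i j / (si * sj),
      dual f i k = cof f j l i k / (si * sk),
      dual f i l = cof f j k i l / (si * sl) &
  [/\ dual f j k = cof f i l j k / (sj * sk),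
      dual f j l = cof f i k j l / (sj * sl) &
      dual f k l = cof f i j k l / (sk * sl)]].
Proof.
split; last split.
- rewrite (@dualE _ k l) //; last by perm4 U.
  by rewrite !(tri_rot fC k l) (mulrC (Num.sqrt _)).
- rewrite (@dualE _ j l) //; last by perm4 U.
  by rewrite (tri_rot fC j l i) (triC23 fC j l k) (mulrC (Num.sqrt _)).
- rewrite (@dualE _ j k) //; last by perm4 U.
  by rewrite (tri_rot fC j k i) (mulrC (Num.sqrt _)).
- rewrite (@dualE _ i l) //; last by perm4 U.
  by rewrite (triC23 fC i l k) (triC23 fC i l j) (mulrC (Num.sqrt _)).
- rewrite (@dualE _ i k) //; last by perm4 U.
  by rewrite (triC23 fC i k j) (mulrC (Num.sqrt _)).
- by rewrite (@dualE _ i j) // (mulrC (Num.sqrt _)).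
Qed.

Hypotheses (ti : 0 < tri f j k l) (tj : 0 < tri f i k l).
Hypotheses (tk : 0 < tri f i j l) (tl : 0 < tri f i j k).

Let si0 : 0 < si. Proof. by rewrite sqrtr_gt0. Qed.
Let sj0 : 0 < sj. Proof. by rewrite sqrtr_gt0. Qed.
Let sk0 : 0 < sk. Proof. by rewrite sqrtr_gt0. Qed.
Let sl0 : 0 < sl. Proof. by rewrite sqrtr_gt0. Qed.
Let siE : tri f j k l = si ^+ 2. Proof. by rewrite sqr_sqrtr ?ltW. Qed.
Let sjE : tri f i k l = sj ^+ 2. Proof. by rewrite sqr_sqrtr ?ltW. Qed.
Let skE : tri f i j l = sk ^+ 2. Proof. by rewrite sqr_sqrtr ?ltW. Qed.
Let slE : tri f i j k = sl ^+ 2. Proof. by rewrite sqr_sqrtr ?ltW. Qed.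

Ltac field_minors := atomize_minors; move: si0 sj0 sk0 sl0;
  generalize si sj sk sl => ? ? ? ? ? ? ? ?; field; by rewrite ?gt_eqF.

(** With one matrix for the lengths and the other for the angles, this is the
sine law: the squared sines of opposite entries are proportional. *)
Lemma one_sub_dual_sqr :
  1 - dual f k l ^+ 2 = det4 f i j k l * (1 - f i j ^+ 2) / (sk * sl) ^+ 2.
Proof.
have [_ _ _ [_ _ ->]] := dual_entries.
rewrite -(jacobi f i j k l) skE slE; field_minors.
Qed.

Lemma tri_dual : tri (dual f) i j k = (det4 f i j k l / (si * sj * sk)) ^+ 2.
Proof.
have [e1 e2 _ [e3 _ _]] := dual_entries.
rewrite expr_div_n -(adj_tri fC i j k l) /tri e1 e2 e3.
rewrite -/(tri f j k l) -/(tri f i k l) -/(tri f i j l) siE sjE skE.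
field_minors.
Qed.

Lemma cof_dual :
  cof (dual f) i j k l
  = det4 f i j k l ^+ 2 * f k l / (si ^+ 2 * sj ^+ 2 * sk * sl).
Proof.
have [e1 e2 e3 [e4 e5 e6]] := dual_entries.
have si2 : si ^+ 2 != 0 by rewrite expf_neq0 // gt_eqF.
have -> : det4 f i j k l ^+ 2 * f k l
    = si ^+ 2 * (det4 f i j k l ^+ 2 * f k l) / si ^+ 2.
  by rewrite [RHS]mulrC mulKf.
rewrite -siE -(adj_cof fC i j k l) siE sjE {1}/cof e1 e2 e3 e4 e5 e6.
field_minors.
Qed.

Lemma det4_dual :
  det4 (dual f) i j k l = det4 f i j k l ^+ 3 / (si * sj * sk * sl) ^+ 2.
Proof.
have [e1 e2 e3 [e4 e5 e6]] := dual_entries.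
rewrite -(adj_det4 fC i j k l) siE sjE skE slE {1}/det4 e1 e2 e3 e4 e5 e6.
field_minors.
Qed.

End Involution.

(** The adjugate of the adjugate of f is (det f)^2 f.  The factor is positive
whatever the sign of the determinant, and the normalization removes it. *)
Lemma dual_dual f i j k l : symm f -> uniq [:: i; j; k; l] ->
  (forall i j k l, uniq [:: i; j; k; l] -> 0 < tri f i j k) ->
  det4 f i j k l != 0 -> dual (dual f) k l = f k l.
Proof.
move=> fC U tf D0.
have ti : 0 < tri f j k l by apply: (tf _ _ _ i); perm4 U.
have tj : 0 < tri f i k l by apply: (tf _ _ _ j); perm4 U.
have tk : 0 < tri f i j l by apply: (tf _ _ _ k); perm4 U.
have tl : 0 < tri f i j k by apply: (tf _ _ _ l).
have U' : uniq [:: i; j; l; k] by perm4 U.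
rewrite (dualE (dualC fC) U) cof_dual // (@tri_dual _ _ i j k l) //.
have := @tri_dual _ fC i j l k U'.
rewrite (triC23 fC j l k) (triC23 fC i l k) => /(_ ti tj tl tk) ->.
rewrite !sqrtr_sqr (det4C34 fC i j l k).
move: ti tj tk tl D0.
rewrite -(sqrtr_gt0 (tri f j k l)) -(sqrtr_gt0 (tri f i k l)).
rewrite -(sqrtr_gt0 (tri f i j l)) -(sqrtr_gt0 (tri f i j k)).
generalize (Num.sqrt (tri f j k l)) (Num.sqrt (tri f i k l)).
generalize (Num.sqrt (tri f i j l)) (Num.sqrt (tri f i j k)).
generalize (det4 f i j k l) (f k l) => D x sk sl si sj si0 sj0 sk0 sl0 D0.
rewrite !normf_div !normrM (gtr0_norm si0) (gtr0_norm sj0) (gtr0_norm sk0).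
rewrite (gtr0_norm sl0) -(real_normK (num_real D)).
by field; rewrite normr_eq0 D0 !gt_eqF.
Qed.

End Dual.

(** * The derivative of the normalized adjugate *)

Section Variation.
Variable R : realType.
Variables (h : R -> 'I_4 -> 'I_4 -> R) (d : 'I_4 -> 'I_4 -> R) (t : R).
Implicit Types i j k l : 'I_4.
Hypothesis dh : forall i j, is_derive t 1 (fun x => h x i j) (d i j).

Lemma is_derive_tri i j k :
  is_derive t 1 (fun x => tri (h x) i j k) (dtri (h t) d i j k).
Proof.
have dij := dh i j; have dik := dh i k; have djk := dh j k.
rewrite (_ : (fun x => _) = cst 1
  + cst 2 * ((fun x => h x i j) * (fun x => h x i k) * (fun x => h x j k))
  - (fun x => h x i j) * (fun x => h x i j)
  - (fun x => h x i k) * (fun x => h x i k)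
  - (fun x => h x j k) * (fun x => h x j k)); last first.
  by apply/funext => x; rewrite /tri !fctE /GRing.scale /=; ring.
have dc (b : R) := is_derive_cst b t (1 : R).
apply: (is_derive_eq (is_deriveB (is_deriveB (is_deriveB (is_deriveD (dc 1)
  (is_deriveM (dc 2) (is_deriveM (is_deriveM dij dik) djk)))
  (is_deriveM dij dij)) (is_deriveM dik dik)) (is_deriveM djk djk))).
rewrite /dtri !fctE /GRing.scale /=; ring.
Qed.

Lemma is_derive_cof i j k l :
  is_derive t 1 (fun x => cof (h x) i j k l) (dcof (h t) d i j k l).
Proof.
have dij := dh i j; have dik := dh i k; have djk := dh j k.
have dil := dh i l; have djl := dh j l; have dkl := dh k l.
rewrite (_ : (fun x => _) =
  ((fun x => h x j k) - (fun x => h x i j) * (fun x => h x i k))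
  * ((fun x => h x j l) - (fun x => h x i j) * (fun x => h x i l))
  - ((fun x => h x k l) - (fun x => h x i k) * (fun x => h x i l))
    * (cst 1 - (fun x => h x i j) * (fun x => h x i j))); last first.
  by apply/funext => x; rewrite /cof !fctE.
have dc (b : R) := is_derive_cst b t (1 : R).
apply: (is_derive_eq (is_deriveB
  (is_deriveM (is_deriveB djk (is_deriveM dij dik))
              (is_deriveB djl (is_deriveM dij dil)))
  (is_deriveM (is_deriveB dkl (is_deriveM dik dil))
              (is_deriveB (dc 1) (is_deriveM dij dij))))).
rewrite /dcof !fctE /GRing.scale /=; ring.
Qed.

End Variation.

Lemma is_derive_cosine (R : realType) (u v w : R -> R) (t du dv dw : R) :
  0 < v t -> 0 < w t ->
  is_derive t 1 u du -> is_derive t 1 v dv -> is_derive t 1 w dw ->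
  is_derive t 1 (fun x => u x / (Num.sqrt (v x) * Num.sqrt (w x)))
    ((du - u t / 2 * (dv / v t + dw / w t))
     / (Num.sqrt (v t) * Num.sqrt (w t))).
Proof.
move=> v0 w0 hu hv hw.
have dv' := @is_derive1_comp _ Num.sqrt v t _ _ (is_derive1_sqrt v0) hv.
have dw' := @is_derive1_comp _ Num.sqrt w t _ _ (is_derive1_sqrt w0) hw.
rewrite (_ : (fun x => _) =
  u * (fun x => (((Num.sqrt \o v) * (Num.sqrt \o w)) x)^-1)); last first.
  by apply/funext => x; rewrite !fctE.
have nz : ((Num.sqrt \o v) * (Num.sqrt \o w)) t != 0.
  by rewrite !fctE mulf_neq0 // gt_eqF ?sqrtr_gt0.
have dvw := @is_deriveV _ _ t _ 1 nz (is_deriveM dv' dw').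
apply: is_derive_eq; rewrite !fctE /GRing.scale /=.
have := esym (sqr_sqrtr (ltW v0)); have := esym (sqr_sqrtr (ltW w0)).
move: v0 w0; rewrite -(sqrtr_gt0 (v t)) -(sqrtr_gt0 (w t)).
generalize (Num.sqrt (v t)) (Num.sqrt (w t)) => p q p0 q0 -> ->.
by field; rewrite !gt_eqF.
Qed.

Section DualVariation.
Variable R : realType.
Variables (h : R -> 'I_4 -> 'I_4 -> R) (d : 'I_4 -> 'I_4 -> R) (t : R).
Variables i j k l : 'I_4.
Hypothesis hC : forall x, symm (h x).
Hypothesis dC : symm d.
Hypothesis dh : forall i j, is_derive t 1 (fun x => h x i j) (d i j).
Hypothesis U : uniq [:: i; j; k; l].
Let f := h t.
Let c := dual f.
Let si := Num.sqrt (tri f j k l).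
Let sj := Num.sqrt (tri f i k l).
Let sk := Num.sqrt (tri f i j l).
Let sl := Num.sqrt (tri f i j k).
Hypotheses (ti : 0 < tri f j k l) (tj : 0 < tri f i k l).
Hypotheses (tk : 0 < tri f i j l) (tl : 0 < tri f i j k).
Hypothesis D0 : det4 f i j k l != 0.

(** Writing each entry of the adjugate as s_m s_n c_mn gives the differentials
of the minors the common factors si^2, sj^2 and si sj (Di, Dj and Dij below),
which cancel against the normalization. *)
Lemma dual_variation :
  (dcof f d k l i j - cof f k l i j / 2
     * (dtri f d j k l / tri f j k l + dtri f d i k l / tri f i k l))
  / (si * sj)
  = - ((1 - c i j ^+ 2)
        * (si * sj * d i j + si * sk * c j k * d i k + si * sl * c j l * d i l
           + sj * sk * c i k * d j k + sj * sl * c i l * d j l)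
        + wnum c i j k l * (sk * sl * d k l))
     / det4 f i j k l.
Proof.
have fC : symm f := hC t.
have si0 : 0 < si by rewrite sqrtr_gt0.
have sj0 : 0 < sj by rewrite sqrtr_gt0.
have sk0 : 0 < sk by rewrite sqrtr_gt0.
have sl0 : 0 < sl by rewrite sqrtr_gt0.
have siE : tri f j k l = si ^+ 2 by rewrite sqr_sqrtr ?ltW.
have sjE : tri f i k l = sj ^+ 2 by rewrite sqr_sqrtr ?ltW.
have [e1 e2 e3 [e4 e5 e6]] := dual_entries fC U.
have cofE (x y z w : R) : 0 < z -> 0 < w -> x = y / (z * w) -> y = z * w * x.
  by move=> z0 w0 ->; rewrite mulrC divfK // mulf_neq0 // gt_eqF.
have {}e1 := cofE _ _ _ _ si0 sj0 e1; have {}e2 := cofE _ _ _ _ si0 sk0 e2.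
have {}e3 := cofE _ _ _ _ si0 sl0 e3; have {}e4 := cofE _ _ _ _ sj0 sk0 e4.
have {}e5 := cofE _ _ _ _ sj0 sl0 e5; have {}e6 := cofE _ _ _ _ sk0 sl0 e6.
set D := det4 f i j k l.
have Di : dtri f d j k l = si ^+ 2 * (2 / D
  * (sj * sk * (c j k - c i j * c i k) * d j k
     + sj * sl * (c j l - c i j * c i l) * d j l
     + sk * sl * (c k l - c i k * c i l) * d k l)).
  rewrite (canRL (mulKf D0) (det4_dtri fC d i j k l)).
  rewrite siE e1 e2 e3 e4 e5 e6 -/c -/D.
  generalize D si sj sk sl (c i j) (c i k) (c i l) (c j k) (c j l) (c k l) => *.
  ring.
have Dj : dtri f d i k l = sj ^+ 2 * (2 / D
  * (si * sk * (c i k - c i j * c j k) * d i k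
     + si * sl * (c i l - c i j * c j l) * d i l
     + sk * sl * (c k l - c j k * c j l) * d k l)).
  have D1 : det4 f j i k l != 0 by rewrite -det4C12.
  rewrite (canRL (mulKf D1) (det4_dtri fC d j i k l)).
  rewrite -(det4C12 fC i j k l) -(cofC34 fC k l i j) -(cofC12 fC i j k l).
  rewrite (dC j i) sjE e1 e2 e3 e4 e5 e6 -/c -/D.
  generalize D si sj sk sl (c i j) (c i k) (c i l) (c j k) (c j l) (c k l) => *.
  ring.
have Dij : dcof f d k l i j = si * sj * (D^-1
  * (si * sj * (c i j ^+ 2 - 1) * d i j
     + si * sk * (c i j * c i k - c j k) * d i k
     + si * sl * (c i j * c i l - c j l) * d i l
     + sj * sk * (c i j * c j k - c i k) * d j k
     + sj * sl * (c i j * c j l - c i l) * d j l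
     + sk * sl * (2 * c i j * c k l - c i k * c j l - c i l * c j k) * d k l)).
  rewrite (canRL (mulKf D0) (det4_dcof fC dC i j k l)).
  rewrite siE sjE e1 e2 e3 e4 e5 e6 -/c -/D.
  generalize D si sj sk sl (c i j) (c i k) (c i l) (c j k) (c j l) (c k l) => *.
  ring.
rewrite Di Dj Dij e1 -/c siE sjE.
have nz2 (x : R) : 0 < x -> x ^+ 2 != 0.
  by move=> /gt_eqF x0; rewrite expf_neq0 ?x0.
rewrite ![_ ^+ 2 * _ / _]mulrAC !divff ?nz2 // !mul1r.
rewrite -!(mulrA (si * sj)) -mulrBr mulrAC divff ?mul1r ?mulf_neq0 ?gt_eqF //.
rewrite /wnum.
generalize si sj sk sl (c i j) (c i k) (c i l) (c j k) (c j l) (c k l) => *.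
by field; exact: D0.
Qed.

Lemma is_derive_dual :
  is_derive t 1 (fun x => dual (h x) i j)
    (- ((1 - c i j ^+ 2)
        * (si * sj * d i j + si * sk * c j k * d i k + si * sl * c j l * d i l
           + sj * sk * c i k * d j k + sj * sl * c i l * d j l)
        + wnum c i j k l * (sk * sl * d k l))
     / det4 f i j k l).
Proof.
rewrite (_ : (fun x => dual (h x) i j) = fun x => cof (h x) k l i j /
    (Num.sqrt (tri (h x) j k l) * Num.sqrt (tri (h x) i k l))); last first.
  by apply/funext => x; have [-> _ _ _] := dual_entries (hC x) U.
rewrite -dual_variation.
exact: (@is_derive_cosine _ _ (fun x => tri (h x) j k l)
  (fun x => tri (h x) i k l) _ _ _ _ ti tj (is_derive_cof dh k l i j)
  (is_derive_tri dh j k l) (is_derive_tri dh i k l)).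
Qed.

End DualVariation.

(** * The Gram matrix of a tetrahedron and its dihedral angles *)

(** These signs of the minors say that lam c has the signature of the form; the
last one puts all the vertices on the same sheet of the hyperboloid. *)
Definition tetra_gram (R : rcfType) (lam : R) (c : 'I_4 -> 'I_4 -> R) : Prop :=
  [/\ symm c, forall i, c i i = 1 & forall i j k l, uniq [:: i; j; k; l] ->
    [/\ 0 < lam * (1 - c i j ^+ 2), 0 < tri c i j k,
        0 < lam * det4 c i j k l & lam = -1 -> 0 < c i j]].

Section Form.
Variables (R : realType) (lam : R).
Hypothesis hlam : lam = 1 \/ lam = -1.
Implicit Types (p q u v w : 'rV[R]_4) (V : 'M[R]_4).
Local Notation "<< u , w >>" := (bform lam u w).

Lemma sqr_lam : lam ^+ 2 = 1.
Proof. by case: hlam => ->; rewrite ?sqrrN expr1n. Qed.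

Lemma bformC u w : <<u, w>> = <<w, u>>.
Proof. by apply: eq_bigr => i _; rewrite mulrAC. Qed.

Lemma bformB u v w : <<u, v - w>> = <<u, v>> - <<u, w>>.
Proof.
by rewrite /bform -sumrB; apply: eq_bigr => i _; rewrite !mxE mulrBr.
Qed.

Lemma bformZ u b w : <<u, b *: w>> = b * <<u, w>>.
Proof.
rewrite /bform big_distrr; apply: eq_bigr => i _ /=.
by rewrite !mxE; ring.
Qed.

Definition bformE := (bformB, bformZ).

Lemma bform_coord u w :
  <<u, w>> = lam * u 0 0 * w 0 0 + \sum_(i < 3) u 0 (lift 0 i) * w 0 (lift 0 i).
Proof.
rewrite /bform big_ord_recl; congr (_ + _).
by apply: eq_bigr => i _; rewrite mul1r.
Qed.

Lemma cauchy_schwarz3 (x y : 'I_3 -> R) :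
  (\sum_i x i * y i) ^+ 2 <= (\sum_i x i ^+ 2) * (\sum_i y i ^+ 2).
Proof.
rewrite !big_ord_recl !big_ord0.
move: (x _) (x _) (x _) (y _) (y _) (y _) => x0 x1 x2 y0 y1 y2.
(* Lagrange's identity *)
rewrite -subr_ge0 [leRHS](_ : _ = (x0 * y1 - x1 * y0) ^+ 2
  + (x0 * y2 - x2 * y0) ^+ 2 + (x1 * y2 - x2 * y1) ^+ 2); last by ring.
by rewrite !addr_ge0 ?sqr_ge0.
Qed.

(** Tangent spaces are positive definite.  On the hyperboloid, write p = (p0, P)
and u = (u0, U): then p0^2 = 1 + |P|^2 and p0 u0 = P.U, so that
(1 + |P|^2) u0^2 <= |P|^2 |U|^2 by Cauchy-Schwarz. *)
Lemma tangent_gt0 p u :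
  in_space lam p -> <<p, u>> = 0 -> u != 0 -> 0 < <<u, u>>.
Proof.
move=> [pp p0] pu u0.
have sq0 (x : 'I_3 -> R) : 0 <= \sum_i x i ^+ 2.
  by apply: sumr_ge0 => i _; exact: sqr_ge0.
have coord : u 0 0 = 0 -> \sum_(i < 3) u 0 (lift 0 i) ^+ 2 = 0 -> u = 0.
  move=> u00 /eqP; rewrite psumr_eq0 => [/allP ui|i _]; last exact: sqr_ge0.
  apply/rowP => i; rewrite mxE; case: (unliftP 0 i) => [m ->|->] //.
  by apply/eqP; rewrite -sqrf_eq0; apply: (ui m); rewrite mem_index_enum.
move: pp pu; rewrite !bform_coord.
have -> : \sum_(i < 3) u 0 (lift 0 i) * u 0 (lift 0 i)
  = \sum_(i < 3) u 0 (lift 0 i) ^+ 2 by [].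
have -> : \sum_(i < 3) p 0 (lift 0 i) * p 0 (lift 0 i)
  = \sum_(i < 3) p 0 (lift 0 i) ^+ 2 by [].
have := cauchy_schwarz3 (fun i => p 0 (lift 0 i)) (fun i => u 0 (lift 0 i)).
move: (sq0 (fun i => u 0 (lift 0 i))) coord (sq0 (fun i => p 0 (lift 0 i))).
move: (\sum_(i < 3) u 0 (lift 0 i) ^+ 2) (\sum_(i < 3) p 0 (lift 0 i) ^+ 2).
move: (\sum_(i < 3) _) => d U P U0 coord P0 CS pp pu.
case: hlam pp pu => -> pp pu.
  rewrite mul1r -expr2 lt0r addr_ge0 ?sqr_ge0 // andbT paddr_eq0 ?sqr_ge0 //.
  apply: contra_neqN u0; rewrite sqrf_eq0 => /andP[/eqP u00 /eqP U00].
  exact: coord.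
have E : p 0 0 * u 0 0 = d by lra.
have E2 : p 0 0 ^+ 2 = 1 + P by rewrite expr2; lra.
have P1 : 0 < 1 + P by rewrite ltr_wpDr.
have key : U <= (1 + P) * (U - u 0 0 ^+ 2).
  have : (1 + P) * u 0 0 ^+ 2 <= P * U by rewrite -E2 -exprMn E.
  by rewrite mulrBr; lra.
have [Upos|] := ltP 0 U.
  have : 0 < (1 + P) * (U - u 0 0 ^+ 2) by exact: lt_le_trans key.
  by rewrite pmulr_rgt0 // expr2; lra.
move=> Uneg; have U00 : U = 0 by apply/eqP; rewrite eq_le Uneg.
case/eqP: u0; apply: coord => //; apply/eqP.
rewrite -sqrf_eq0 eq_le sqr_ge0 andbT.
by move: key; rewrite U00 sub0r mulrN oppr_ge0 pmulr_rle0.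
Qed.

Lemma hyperboloid_lt0 p q :
  lam = -1 -> in_space lam p -> in_space lam q -> <<p, q>> < 0.
Proof.
move=> lamN [pp /(_ lamN) p0] [qq /(_ lamN) q0]; move: pp qq.
rewrite !bform_coord lamN.
have -> : \sum_(i < 3) q 0 (lift 0 i) * q 0 (lift 0 i)
  = \sum_(i < 3) q 0 (lift 0 i) ^+ 2 by [].
have -> : \sum_(i < 3) p 0 (lift 0 i) * p 0 (lift 0 i)
  = \sum_(i < 3) p 0 (lift 0 i) ^+ 2 by [].
have := cauchy_schwarz3 (fun i => p 0 (lift 0 i)) (fun i => q 0 (lift 0 i)).
have sq0 (x : 'I_3 -> R) : 0 <= \sum_i x i ^+ 2.
  by apply: sumr_ge0 => i _; exact: sqr_ge0.
move: (sq0 (fun i => q 0 (lift 0 i))) (sq0 (fun i => p 0 (lift 0 i))).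
move: (\sum_(i < 3) q 0 (lift 0 i) ^+ 2) (\sum_(i < 3) p 0 (lift 0 i) ^+ 2).
move: (\sum_(i < 3) _) => d U P U0 P0 CS pp qq.
have pq0 := mulr_gt0 p0 q0.
have Ep : p 0 0 ^+ 2 = 1 + P by rewrite expr2; lra.
have Eq : q 0 0 ^+ 2 = 1 + U by rewrite expr2; lra.
have : d ^+ 2 < (p 0 0 * q 0 0) ^+ 2.
  rewrite exprMn Ep Eq; apply: le_lt_trans CS _.
  by rewrite mulrDl mul1r mulrDr mulr1 addrA ltrDr; lra.
rewrite -(ltr_sqrt _ (exprn_gt0 2 pq0)) !sqrtr_sqr (gtr0_norm pq0) ltr_norml.
by move=> /andP[_ dpq]; lra.
Qed.

Definition cgram V i j : R := lam * <<row i V, row j V>>.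

Lemma cgramC V : symm (cgram V).
Proof. by move=> i j; rewrite /cgram bformC. Qed.

Lemma cgram_bform V i j : <<row i V, row j V>> = lam * cgram V i j.
Proof. by rewrite mulrA -expr2 sqr_lam mul1r. Qed.

Lemma orthE u w w' : <<u, u>> != 0 ->
  <<orth lam u w, orth lam u w'>>
  = <<w, w'>> - <<u, w>> * <<u, w'>> / <<u, u>>.
Proof.
move=> u0; rewrite /orth !bformE (bformC _ w') (bformC _ u) !bformE.
by rewrite (bformC w' u) (bformC w' w); field.
Qed.

Lemma orth_tangent p u w :
  <<p, u>> = 0 -> <<p, w>> = 0 -> <<p, orth lam u w>> = 0.
Proof. by move=> pu pw; rewrite /orth !bformE pu pw mulr0 subr0. Qed.

Lemma direction_tangent p q : <<p, p>> = lam -> <<p, direction lam p q>> = 0.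
Proof.
move=> pp; rewrite /direction !bformE pp mulrAC -expr2 sqr_lam mul1r subrr //.
Qed.

(** Each vector produced by Gram-Schmidt has this form. *)
Lemma independent_neq0 V i j k l (x y z : R) :
  row_free V -> uniq [:: i; j; k; l] ->
  row l V + x *: row k V + y *: row j V + z *: row i V != 0.
Proof.
move=> Vf U; apply/eqP.
have -> : row l V + x *: row k V + y *: row j V + z *: row i V
  = (delta_mx 0 l + x *: delta_mx 0 k + y *: delta_mx 0 j
     + z *: delta_mx 0 i) *m V.
  by rewrite !mulmxDl -!scalemxAl -!rowE.
move=> /eqP; rewrite mulmx_free_eq0 // => /eqP/rowP/(_ l).
move: U; rewrite /= !inE !negb_or -!andbA.
move=> /and5P[_ _ /negPf il _ /and3P[/negPf jl /negPf kl _]].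
rewrite !mxE !eqxx /= (eq_sym l k) (eq_sym l j) (eq_sym l i) il jl kl.
by rewrite !mulr0 !addr0 => /eqP; rewrite oner_eq0.
Qed.

Section Tetrahedron.
Variable V : 'M[R]_4.
Hypothesis hV : tetrahedron lam V.
Let c := cgram V.
Let cC : symm c := cgramC V.

Lemma cgram_diag i : c i i = 1.
Proof.
by rewrite /c /cgram; have [/(_ i)[-> _] _] := hV; rewrite -expr2 sqr_lam.
Qed.

Section Frame.
Variables i j k l : 'I_4.
Hypothesis U : uniq [:: i; j; k; l].
Let e m := direction lam (row i V) (row m V).
Let A := orth lam (e j) (e k).
Let B := orth lam (e j) (e l).
Let mu := lam * (1 - c i j ^+ 2).

Lemma direction_bform m n : <<e m, e n>> = lam * (c m n - c i m * c i n).
Proof.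
rewrite /e /direction !bformE (bformC _ (row n V)) (bformC _ (row i V)) !bformE.
rewrite !cgram_bform -/c (cC n m) (cC n i) cgram_diag.
transitivity (lam * c m n - lam ^+ 2 * lam * c i m * c i n
  - lam ^+ 2 * lam * c i n * c i m + lam ^+ 2 * lam ^+ 2 * lam * c i n * c i m).
  by ring.
by rewrite sqr_lam; ring.
Qed.

(** The directions at v_i of the three edges, orthogonalized one after another,
are nonzero tangent vectors, hence of positive square. *)
Lemma frame_pos :
  [/\ 0 < mu, 0 < <<A, A>> & 0 < <<orth lam A B, orth lam A B>>].
Proof.
have [/(_ i) pi Vf] := hV; have [pp _] := pi.
have te m : <<row i V, e m>> = 0 by exact: direction_tangent.
have mu0 : 0 < <<e j, e j>>.
  apply: (tangent_gt0 pi) => //.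
  have U' : uniq [:: i; k; l; j] by perm4 U.
  have := independent_neq0 0 0 (- (lam * <<row i V, row j V>>)) Vf U'.
  by rewrite !scale0r !addr0 scaleNr.
have mu1 := gt_eqF mu0.
have tA : <<row i V, A>> = 0 by exact: orth_tangent.
have tB : <<row i V, B>> = 0 by exact: orth_tangent.
have A0 : 0 < <<A, A>>.
  apply: (tangent_gt0 pi) => //.
  have U' : uniq [:: i; l; j; k] by perm4 U.
  set x := <<e j, e k>> / <<e j, e j>>.
  have := independent_neq0 (- x) 0 (x * (lam * <<row i V, row j V>>)
     - (lam * <<row i V, row k V>>)) Vf U'.
  apply: contra_neq; rewrite /A /orth -/x /e /direction => E.
  rewrite -[RHS]E; apply/rowP => m; rewrite !mxE; ring.
split=> //.
  by move: mu0; rewrite direction_bform cgram_diag -expr2.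
apply: (tangent_gt0 pi); first exact: orth_tangent.
set y := <<A, B>> / <<A, A>>.
set x := <<e j, e k>> / <<e j, e j>>.
set x' := <<e j, e l>> / <<e j, e j>>.
have := independent_neq0 (- y) (y * x - x')
  (x' * (lam * <<row i V, row j V>>) - (lam * <<row i V, row l V>>)
   + y * (lam * <<row i V, row k V>>) - y * x * (lam * <<row i V, row j V>>))
  Vf U.
apply: contra_neq; rewrite /orth -/y /A /B /orth -/x -/x' /e /direction => E.
by rewrite -[RHS]E; apply/rowP => m; rewrite !mxE; ring.
Qed.

Let mu0 : 0 < mu. Proof. by have [] := frame_pos. Qed.

(** Projecting along the edge direction is one pivot step; Sylvester's identity
identifies the result with minors of c. *)
Lemma frame_bform m n :
  <<orth lam (e j) (e m), orth lam (e j) (e n)>> = - cof c i j m n / mu.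
Proof.
have ejE : <<e j, e j>> = mu by rewrite direction_bform cgram_diag -expr2.
rewrite orthE ?ejE ?gt_eqF // !direction_bform /cof.
have muN : mu != 0 by rewrite gt_eqF.
have -> : lam * (c m n - c i m * c i n)
    = (c m n - c i m * c i n) * (1 - c i j ^+ 2) / mu.
  apply: (canRL (mulfK muN)); rewrite /mu mulrACA -expr2 sqr_lam.
  by rewrite mul1r.
rewrite [lam * _ * _]mulrACA -expr2 sqr_lam mul1r -mulrBl; congr (_ / _).
by generalize c => f; ring.
Qed.

Lemma cof_diag m : cof c i j m m = - tri c i j m.
Proof. by rewrite /cof /tri cgram_diag; generalize c => f; ring. Qed.

Lemma frame_tri m :
  <<orth lam (e j) (e m), orth lam (e j) (e m)>> = tri c i j m / mu.
Proof. by rewrite frame_bform cof_diag opprK. Qed.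

Lemma frame_gram :
  [/\ 0 < mu, 0 < tri c i j k
    & 0 < tri c i j k * tri c i j l - cof c i j k l ^+ 2].
Proof.
have [_ A0 B0] := frame_pos.
have tk : 0 < tri c i j k.
  by move: A0; rewrite /A frame_tri pmulr_lgt0 ?invr_gt0.
split => //; move: B0.
rewrite orthE ?gt_eqF // /A /B (frame_bform k l) !frame_tri.
rewrite (_ : _ - _ = (tri c i j k * tri c i j l - cof c i j k l ^+ 2)
  / (tri c i j k * mu)); first by rewrite pmulr_lgt0 // invr_gt0 mulr_gt0.
have muN : mu != 0 by rewrite gt_eqF.
have tN : tri c i j k != 0 by rewrite gt_eqF.
move: muN tN; generalize mu (tri c i j k) (tri c i j l) (cof c i j k l).
by move=> *; field; apply/andP.
Qed.

(** The left-hand side is the cosine of the dihedral angle at v_i v_j. *)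
Lemma cos_angle_dual (tk : 0 < tri c i j k) (tl : 0 < tri c i j l) :
  <<A, B>> / (Num.sqrt <<A, A>> * Num.sqrt <<B, B>>) = - dual c k l.
Proof.
have sqrt_div x : 0 < x -> Num.sqrt (x / mu) = Num.sqrt x / Num.sqrt mu.
  by move=> x0; rewrite sqrtrM ?ltW // sqrtrV // ltW.
rewrite (dualE cC U) /A /B (frame_bform k l) !frame_tri !sqrt_div //.
rewrite mulf_div -(expr2 (Num.sqrt mu)) sqr_sqrtr ?ltW //.
have muN : mu != 0 by rewrite gt_eqF.
have pN : Num.sqrt (tri c i j k) != 0 by rewrite gt_eqF // sqrtr_gt0.
have qN : Num.sqrt (tri c i j l) != 0 by rewrite gt_eqF // sqrtr_gt0.
move: muN pN qN; set p := Num.sqrt _; set q := Num.sqrt _.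
by move: p q mu (cof c i j k l) => *; field; apply/and3P.
Qed.

End Frame.

(** The sign of the determinant follows from Jacobi's identity, as the minor of
size 2 of the adjugate is the Gram determinant of the last Gram-Schmidt step. *)
Lemma tetrahedron_gram : tetra_gram lam c.
Proof.
split; [exact: cC|exact: cgram_diag|move=> i j k l U].
have [mu0 tk T] := frame_gram U; split=> //; last first.
  move=> lamN; have [hs _] := hV; rewrite /c /cgram {1}lamN mulN1r oppr_gt0.
  exact: hyperboloid_lt0.
move: T; rewrite jacobi => T.
have : 0 < lam * det4 c i j k l * (lam * (1 - c i j ^+ 2)).
  by rewrite mulrACA -expr2 sqr_lam mul1r.
by rewrite pmulr_lgt0.
Qed.

Lemma dual_cgram_lt1 i j k l : uniq [:: i; j; k; l] -> - 1 < dual c k l < 1.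
Proof.
move=> U; have [_ _ /(_ i j k l U) [mu0 tk D0 _]] := tetrahedron_gram.
have U' : uniq [:: i; j; l; k] by perm4 U.
have [_ _ /(_ i j l k U') [_ tl _ _]] := tetrahedron_gram.
have U1 : uniq [:: j; k; l; i] by perm4 U.
have U2 : uniq [:: i; k; l; j] by perm4 U.
have [_ _ /(_ j k l i U1) [_ ti _ _]] := tetrahedron_gram.
have [_ _ /(_ i k l j U2) [_ tj _ _]] := tetrahedron_gram.
rewrite -ltr_norml -(@expr_lt1 _ 2) ?normr_ge0 //.
rewrite real_normK ?num_real // -subr_gt0.
rewrite (one_sub_dual_sqr cC U ti tj tl tk).
have s0 : 0 < Num.sqrt (tri c i j l) * Num.sqrt (tri c i j k).
  by rewrite mulr_gt0 ?sqrtr_gt0.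
apply: divr_gt0; last exact: exprn_gt0.
by have := mulr_gt0 D0 mu0; rewrite mulrACA -expr2 sqr_lam mul1r.
Qed.

Lemma dihedral_dual i j k l : uniq [:: i; j; k; l] ->
  dihedral lam V i j k l = acos (- dual c k l).
Proof.
move=> U; rewrite /dihedral /vangle cos_angle_dual //.
  by have [] := frame_gram U.
have U' : uniq [:: i; j; l; k] by perm4 U.
by have [] := frame_gram U'.
Qed.

End Tetrahedron.
End Form.

(** * Realization of a Gram matrix *)

Section Realization.
Variables (R : realType) (lam : R).
Hypothesis hlam : lam = 1 \/ lam = -1.

Lemma ord4_cases (P : 'I_4 -> Prop) :
  P (@Ordinal 4 0 isT) -> P (@Ordinal 4 1 isT) -> P (@Ordinal 4 2 isT) ->
  P (@Ordinal 4 3 isT) -> forall i, P i.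
Proof.
move=> P0 P1 P2 P3 [[|[|[|[|//]]]] im].
- by rewrite (bool_irrelevance im isT).
- by rewrite (bool_irrelevance im isT).
- by rewrite (bool_irrelevance im isT).
- by rewrite (bool_irrelevance im isT).
Qed.

Lemma bform_seq (r : 'I_4 -> seq R) i j :
  let V := \matrix_(i, j) (r i)`_j in
  bform lam (row i V) (row j V)
  = lam * (r i)`_0 * (r j)`_0 + (r i)`_1 * (r j)`_1
    + (r i)`_2 * (r j)`_2 + (r i)`_3 * (r j)`_3.
Proof.
by rewrite /bform !big_ord_recl big_ord0 !mxE /= !mul1r addr0 !addrA.
Qed.

(** The rows of the Cholesky factor of lam c: the first vertex is the base
point (1, 0, 0, 0), the first coordinates are the entries c_0j, and b^2 = mu,
g^2 and d^2 are the pivots of the remaining positive definite block. *)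
Lemma realize_gram (c : 'I_4 -> 'I_4 -> R) : tetra_gram lam c ->
  exists2 V, tetrahedron lam V & forall i j, cgram lam V i j = c i j.
Proof.
have l2 := sqr_lam hlam.
pose o0 := @Ordinal 4 0 isT; pose o1 := @Ordinal 4 1 isT.
pose o2 := @Ordinal 4 2 isT; pose o3 := @Ordinal 4 3 isT.
move=> [cC c1 cg].
have [mu0 t2 D0 _] := cg o0 o1 o2 o3 isT.
pose mu := lam * (1 - c o0 o1 ^+ 2); rewrite -/mu in mu0.
pose b := Num.sqrt mu.
pose g := Num.sqrt (tri c o0 o1 o2 / mu).
pose d := Num.sqrt (lam * det4 c o0 o1 o2 o3 / tri c o0 o1 o2).
pose x := lam * (c o1 o2 - c o0 o1 * c o0 o2) / b.
pose y := lam * (c o1 o3 - c o0 o1 * c o0 o3) / b.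
pose z := - cof c o0 o1 o2 o3 / (mu * g).
pose r (i : 'I_4) := nth [::] [:: [:: 1]; [:: c o0 o1; b];
  [:: c o0 o2; x; g]; [:: c o0 o3; y; z; d]] i.
pose V := \matrix_(i < 4, j < 4) (r i)`_j.
have b0 : 0 < b by rewrite sqrtr_gt0.
have g0 : 0 < g by rewrite sqrtr_gt0 divr_gt0.
have d0 : 0 < d by rewrite sqrtr_gt0 divr_gt0.
have bE : b ^+ 2 = mu by rewrite sqr_sqrtr ?ltW.
have gE : g ^+ 2 = tri c o0 o1 o2 / mu by rewrite sqr_sqrtr ?ltW ?divr_gt0.
have dE : d ^+ 2 = lam * det4 c o0 o1 o2 o3 / tri c o0 o1 o2.
  by rewrite sqr_sqrtr ?ltW ?divr_gt0.
have muN : mu != 0 by rewrite gt_eqF.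
have tN : tri c o0 o1 o2 != 0 by rewrite gt_eqF.
have bN : b != 0 by rewrite gt_eqF.
have gN : g != 0 by rewrite gt_eqF.
have E12 : b * x = lam * (c o1 o2 - c o0 o1 * c o0 o2).
  by rewrite mulrC divfK.
have E13 : b * y = lam * (c o1 o3 - c o0 o1 * c o0 o3).
  by rewrite mulrC divfK.
have xE : x ^+ 2 = (c o1 o2 - c o0 o1 * c o0 o2) ^+ 2 / mu.
  by rewrite expr_div_n exprMn l2 bE mul1r.
have yE : y ^+ 2 = (c o1 o3 - c o0 o1 * c o0 o3) ^+ 2 / mu.
  by rewrite expr_div_n exprMn l2 bE mul1r.
have xyE : x * y = (c o1 o2 - c o0 o1 * c o0 o2)
                   * (c o1 o3 - c o0 o1 * c o0 o3) / mu.
  by rewrite mulf_div -expr2 bE mulrACA -expr2 l2 mul1r.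
have gzE : g * z = - cof c o0 o1 o2 o3 / mu.
  rewrite /z; move: muN gN; generalize mu g (cof c o0 o1 o2 o3) => ? ? ? ? ?.
  by field; apply/andP.
have zE : z ^+ 2 = cof c o0 o1 o2 o3 ^+ 2 / (mu * tri c o0 o1 o2).
  rewrite /z expr_div_n sqrrN exprMn gE; congr (_ / _).
  by rewrite expr2 -mulrA; congr (_ * _); rewrite mulrC divfK.
have muV : (1 - c o0 o1 ^+ 2) / mu = lam.
  apply: (canLR (mulfK muN)); by rewrite /mu mulrA -expr2 l2 mul1r.
have gram_le : forall i j : 'I_4, (i <= j)%N ->
   lam * (r i)`_0 * (r j)`_0 + (r i)`_1 * (r j)`_1
    + (r i)`_2 * (r j)`_2 + (r i)`_3 * (r j)`_3 = lam * c i j.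
  apply: ord4_cases; apply: ord4_cases => //= _; rewrite -/o0 -/o1 -/o2 -/o3;
    rewrite ?(mul0r, mulr1, addr0) ?c1 ?mulr1 //.
  - by rewrite -mulrA -!expr2 bE /mu -mulrDr addrC subrK mulr1.
  - by rewrite E12 mulrBr mulrA addrC subrK.
  - by rewrite E13 mulrBr mulrA addrC subrK.
  - rewrite -!expr2 xE gE -addrA -mulrDl.
    rewrite (_ : _ + tri _ _ _ _ = (1 - c o0 o2 ^+ 2) * (1 - c o0 o1 ^+ 2)).
      by rewrite -[_ * _ / mu]mulrA muV; ring.
    by rewrite /tri; ring.
  - rewrite xyE gzE -addrA -mulrDl.
    rewrite (_ : _ - cof _ _ _ _ _
      = (c o2 o3 - c o0 o2 * c o0 o3) * (1 - c o0 o1 ^+ 2)).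
      by rewrite -[_ * _ / mu]mulrA muV; ring.
    by rewrite /cof; ring.
  - rewrite -!expr2 yE zE dE.
    have -> : lam * det4 c o0 o1 o2 o3 / tri c o0 o1 o2
      = det4 c o0 o1 o2 o3 * (1 - c o0 o1 ^+ 2) / (mu * tri c o0 o1 o2).
      rewrite -{1}muV; move: muN tN.
      generalize mu (tri c o0 o1 o2) (det4 c o0 o1 o2 o3) (1 - c o0 o1 ^+ 2).
      by move=> *; field; apply/andP.
    rewrite -addrA -[X in _ + X]mulrDl -(jacobi c o0 o1 o2 o3).
    rewrite [X in X / (mu * _)]addrC subrK.
    rewrite [mu * _]mulrC -(mulf_div (tri c o0 o1 o2) (tri c o0 o1 o2)).
    rewrite divff // mul1r -addrA -mulrDl.
    rewrite (_ : _ + tri _ _ _ _ = (1 - c o0 o3 ^+ 2) * (1 - c o0 o1 ^+ 2)).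
      by rewrite -[_ * _ / mu]mulrA muV; ring.
    by rewrite /tri; ring.
have gram i j : bform lam (row i V) (row j V) = lam * c i j.
  rewrite bform_seq; have [ij|/ltnW ji] := leqP i j; first exact: gram_le.
  rewrite cC -gram_le // -!(mulrA lam) (mulrC (r i)`_0) (mulrC (r i)`_1).
  by rewrite (mulrC (r i)`_2) (mulrC (r i)`_3).
exists V; last by move=> i j; rewrite /cgram gram mulrA -expr2 l2 mul1r.
split.
  move=> i; split; first by rewrite gram c1 mulr1.
  move=> lamN; rewrite !mxE; move: i; apply: ord4_cases => //=.
  - by have [_ _ _ ->] := cg o0 o1 o2 o3 isT.
  - by have [_ _ _ ->] := cg o0 o2 o1 o3 isT.
  - by have [_ _ _ ->] := cg o0 o3 o1 o2 isT.
rewrite row_free_unit unitmxE det_trig.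
  rewrite unitfE !big_ord_recl big_ord0 !mxE /= !mulf_neq0 ?oner_eq0 //.
  by rewrite gt_eqF.
apply/is_trig_mxP; apply: ord4_cases; apply: ord4_cases => //= _;
  by rewrite mxE.
Qed.

End Realization.

(** * Lengths as functions of the angles *)

Section Angles.
Variables (R : realType) (lam : R).
Hypothesis hlam : lam = 1 \/ lam = -1.
Implicit Types (a : 'I_4 -> 'I_4 -> R) (V : 'M[R]_4) (i j k l : 'I_4).

Lemma mul_cube_gt0 (x y : R) : 0 < x * y -> 0 < x * y ^+ 3.
Proof.
move=> xy; rewrite exprS mulrA mulr_gt0 // exprn_even_gt0 //.
by apply: contraTneq xy => ->; rewrite mulr0 ltxx.
Qed.

(** The Gram matrix of the outer unit normals of the faces; the face normals
numbered k and l, opposite to v_k and v_l, belong to the faces that meet at the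
edge opposite to v_k v_l. *)
Definition face_gram a : 'I_4 -> 'I_4 -> R :=
  at_opposite (fun i j => - cos (a i j)).

Lemma face_gramE a i j k l :
  symm a -> uniq [:: i; j; k; l] -> face_gram a k l = - cos (a i j).
Proof.
by move=> aC U; rewrite /face_gram (at_oppositeE _ U) // => i' j'; rewrite aC.
Qed.

Lemma face_gram_diag a k : face_gram a k k = 1.
Proof. exact: at_opposite_diag. Qed.

Lemma face_gramC a : symm a -> symm (face_gram a).
Proof.
move=> aC k l; have [->//|kl] := eqVneq k l.
have [i [j U]] := ord4_complement kl.
have U' : uniq [:: i; j; l; k] by perm4 U.
by rewrite (face_gramE aC U) (face_gramE aC U').
Qed.

(** Open conditions that characterize the dihedral angles of tetrahedra, see
angles_realizable and realize_angles. *)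
Definition realizable a : Prop :=
  [/\ symm a, forall i j, i != j -> 0 < a i j < pi &
      forall i j k l, uniq [:: i; j; k; l] ->
      let f := face_gram a in
      [/\ 0 < tri f i j k, 0 < lam * det4 f i j k l
        & lam = -1 -> 0 < cof f i j k l]].

Lemma one_sub_face_gram_sqr a i j k l : symm a -> 0 < a i j < pi ->
  uniq [:: i; j; k; l] -> 0 < 1 - face_gram a k l ^+ 2.
Proof.
move=> aC aij U; rewrite (face_gramE aC U) sqrrN -sin2cos2 exprn_gt0 //.
exact: sin_gt0_pi.
Qed.

Section Rigidity.
Variables (V : 'M[R]_4) (a : 'I_4 -> 'I_4 -> R).
Hypotheses (hV : tetrahedron lam V) (ha : has_dihedral_angles lam V a).
Let c := cgram lam V.
Let cC : symm c := cgramC lam V.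

Lemma angleE i j k l : uniq [:: i; j; k; l] -> a i j = acos (- dual c k l).
Proof. by move=> U; rewrite (ha U) dihedral_dual. Qed.

Lemma angle_symm : symm a.
Proof.
move=> i j; have [->//|ij] := eqVneq i j.
have [k [l U]] := ord4_complement ij.
have U1 : uniq [:: i; j; k; l] by perm4 U.
have U2 : uniq [:: j; i; k; l] by perm4 U.
by rewrite (angleE U1) (angleE U2).
Qed.

Lemma angle_range i j k l : uniq [:: i; j; k; l] -> 0 < a i j < pi.
Proof.
move=> U; rewrite (angleE U); have /andP[h1 h2] := dual_cgram_lt1 hlam hV U.
move: (dual c k l) h1 h2 => x h1 h2.
apply/andP; split; first by apply: acos_gt0; apply/andP; split; lra.
by apply: acos_ltpi; apply/andP; split; lra.
Qed.

Lemma face_gram_dual : face_gram a = dual c.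
Proof.
apply/funext => k; apply/funext => l.
have [->|kl] := eqVneq k l; first by rewrite face_gram_diag dual_diag.
have [i [j U]] := ord4_complement kl.
rewrite (face_gramE angle_symm U) (angleE U) acosK ?opprK // in_itv /=.
have /andP[h1 h2] := dual_cgram_lt1 hlam hV U.
by move: (dual c k l) h1 h2 => x h1 h2; apply/andP; split; lra.
Qed.

(** The angles determine the Gram matrix of the vertices. *)
Lemma cgram_face_gram : c = dual (face_gram a).
Proof.
have [_ c1 cg] := tetrahedron_gram hlam hV.
apply/funext => k; apply/funext => l; rewrite face_gram_dual.
have [->|kl] := eqVneq k l; first by rewrite dual_diag; exact: c1.
have [i [j U]] := ord4_complement kl.
rewrite (dual_dual cC U) //; first by move=> ? ? ? ? /cg[].
have [_ _ D0 _] := cg _ _ _ _ U.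
by apply: contraTneq D0 => ->; rewrite mulr0 ltxx.
Qed.

Lemma angles_realizable : realizable a.
Proof.
have [_ c1 cg] := tetrahedron_gram hlam hV.
split; first exact: angle_symm.
  move=> i j ij; have [k [l U]] := ord4_complement ij.
  by apply: (@angle_range i j k l); perm4 U.
move=> i j k l U f; rewrite /f face_gram_dual.
have [_ tl D0 _] := cg _ _ _ _ U.
have [|_ ti _ _] := cg j k l i; first by perm4 U.
have [|_ tj _ _] := cg i k l j; first by perm4 U.
have [|_ tk _ _] := cg i j l k; first by perm4 U.
have [|_ _ _ ckl] := cg k l i j; first by perm4 U.
have DN : det4 c i j k l != 0.
  by apply: contraTneq D0 => ->; rewrite mulr0 ltxx.
rewrite (tri_dual cC U) // (det4_dual cC U) // (cof_dual cC U) //.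
have s0 x : 0 < x -> 0 < Num.sqrt x :> R by rewrite sqrtr_gt0.
split.
- rewrite exprn_even_gt0 //= mulf_neq0 // invr_neq0 //.
  by rewrite !mulf_neq0 ?gt_eqF ?s0.
- by rewrite mulrA (divr_gt0 (mul_cube_gt0 D0)) // exprn_gt0 // !mulr_gt0 ?s0.
- move=> /ckl c0.
  have D2 : 0 < det4 c i j k l ^+ 2 by rewrite exprn_even_gt0.
  by rewrite (divr_gt0 (mulr_gt0 D2 c0)) // !mulr_gt0 ?exprn_gt0 ?s0.
Qed.

End Rigidity.

(** The signs of the minors of h determine those of its normalized adjugate,
which is therefore realized; its own normalized adjugate is h again. *)
Lemma realize_angles a : realizable a ->
  exists2 V, tetrahedron lam V & has_dihedral_angles lam V a.
Proof.
move=> [aC ar af]; pose f := face_gram a.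
have fC : symm f by exact: face_gramC.
have s0 x : 0 < x -> 0 < Num.sqrt x :> R by rewrite sqrtr_gt0.
have /(realize_gram hlam)[V hV hc] : tetra_gram lam (dual f).
  split; [exact: dualC|exact: dual_diag|move=> i j k l U].
  have U' : uniq [:: k; l; i; j] by perm4 U.
  have [tl D0 _] := af _ _ _ _ U.
  have [|ti _ _] := af j k l i; first by perm4 U.
  have [|tj _ _] := af i k l j; first by perm4 U.
  have [|tk _ _] := af i j l k; first by perm4 U.
  have [tj' D0' cij] := af _ _ _ _ U'.
  have [|ti' _ _] := af k l j i; first by perm4 U.
  have [|tk' _ _] := af l i j k; first by perm4 U.
  have [|tl' _ _] := af k i j l; first by perm4 U.
  rewrite -/f in tl D0 ti tj tk tj' D0' cij ti' tk' tl'.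
  have DN : det4 f i j k l != 0.
    by apply: contraTneq D0 => ->; rewrite mulr0 ltxx.
  rewrite (tri_dual fC U) // (det4_dual fC U) // (one_sub_dual_sqr fC U') //.
  have fkl : 0 < 1 - f k l ^+ 2.
    apply: (@one_sub_face_gram_sqr a i j) => //; apply: ar.
    exact: uniq4_neq U.
  split.
  - rewrite !mulrA (divr_gt0 (mulr_gt0 D0' fkl)) //.
    by rewrite exprn_gt0 // !mulr_gt0 ?s0.
  - rewrite exprn_even_gt0 //= mulf_neq0 // invr_neq0 //.
    by rewrite !mulf_neq0 ?gt_eqF ?s0.
  - by rewrite mulrA (divr_gt0 (mul_cube_gt0 D0)) // exprn_gt0 // !mulr_gt0 ?s0.
  - by move=> /cij c0; rewrite (dualE fC U') divr_gt0 ?mulr_gt0 ?s0.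
exists V => // i j k l U.
have ij := uniq4_neq U; have /andP[a0 api] := ar _ _ ij.
have -> : dihedral lam V i j k l = acos (- dual (dual f) k l).
  rewrite dihedral_dual //; congr (acos (- dual _ k l)).
  by apply/funext => m; apply/funext => n; rewrite hc.
have [_ D0 _] := af _ _ _ _ U; rewrite -/f in D0.
rewrite (dual_dual fC U); last first.
- by apply: contraTneq D0 => ->; rewrite mulr0 ltxx.
- by move=> ? ? ? ? /af[].
by rewrite /f (face_gramE aC U) opprK cosK // in_itv /= !ltW.
Qed.

Definition dist_of_cos x : R := if lam == 1 then acos x else acosh x.

Lemma edge_lengthE V i j :
  edge_length lam V i j = dist_of_cos (cgram lam V i j).
Proof.
rewrite /edge_length /gdist /dist_of_cos /cgram; case: hlam => ->.
  by rewrite eqxx mul1r.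
have -> : (-1 == 1 :> R) = false by apply/eqP; lra.
by rewrite mulN1r.
Qed.

Lemma length_of_anglesE a i j : realizable a ->
  length_of_angles lam a i j = dist_of_cos (dual (face_gram a) i j).
Proof.
move=> /realize_angles[W hW aW]; rewrite /length_of_angles.
have /(@xgetPex _ 0)[] :
    exists V, tetrahedron lam V /\ has_dihedral_angles lam V a by exists W.
set V := xget _ _ => hV aV.
by rewrite edge_lengthE (cgram_face_gram hV aV).
Qed.

End Angles.

(** * The length as a function of its cosine *)

Section DistOfCos.
Local Open Scope complex_scope.
Variables (R : realType).
Implicit Types x : R.

Lemma is_derive_acosh x :
  1 < x -> is_derive x 1 (@acosh R) (Num.sqrt (x ^+ 2 - 1))^-1.
Proof.
move=> x1; have x0 : 0 < x by lra.
have s0 : 0 < x ^+ 2 - 1 by rewrite subr_gt0 expr_gt1 // ltW.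
have dsq : is_derive x 1 (fun t : R => t ^+ 2 - 1) (2 * x).
  rewrite (_ : (fun t : R => t ^+ 2 - 1) = id * id - cst 1).
    apply: (is_derive_eq (is_deriveB (is_deriveM (is_derive_id x 1)
      (is_derive_id x 1)) (is_derive_cst (1 : R) x 1))).
    by rewrite /GRing.scale /= subr0 mulr1 mulr2n mulrDl mul1r.
  by apply/funext.
have dsqrt := @is_derive1_comp _ Num.sqrt (fun t : R => t ^+ 2 - 1) x _ _
  (is_derive1_sqrt s0) dsq.
have s1 : 0 < Num.sqrt (x ^+ 2 - 1) by rewrite sqrtr_gt0.
have xs0 : 0 < x + Num.sqrt (x ^+ 2 - 1) by rewrite addr_gt0.
apply: (is_derive_eq (@is_derive1_comp _ (@ln R)
  (id + (Num.sqrt \o (fun t : R => t ^+ 2 - 1))) x _ _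
  (is_derive1_ln xs0) (is_deriveD (is_derive_id x 1) dsqrt))).
move: s1 xs0; set s := Num.sqrt _; move: s => s s1 xs0.
by field; rewrite !gt_eqF.
Qed.

Variable lam : R.
Hypothesis hlam : lam = 1 \/ lam = -1.

Let N1 : (-1 == 1 :> R) = false. Proof. by apply/eqP; lra. Qed.

(** Up to the factor sqrt lam, the sine of sqrt lam times the length of
cosine x. *)
Definition lsine x : R := Num.sqrt (lam * (1 - x ^+ 2)).

(** The values of cos (sqrt lam t) at the distances t of independent points. *)
Definition proper_cosine x := 0 < lam * (1 - x ^+ 2) /\ (lam = -1 -> 0 < x).

Lemma proper_cosine1 x : lam = 1 -> proper_cosine x -> -1 < x < 1.
Proof.
move=> l1 []; rewrite {1}l1 mul1r subr_gt0 => x1 _.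
by rewrite -ltr_norml -(@expr_lt1 _ 2) ?normr_ge0 // real_normK ?num_real.
Qed.

Lemma proper_cosineN1 x : lam = -1 -> proper_cosine x -> 1 < x.
Proof.
move=> lamN []; rewrite {1}lamN mulN1r opprB subr_gt0 => x1 /(_ lamN) x0.
by rewrite -(@expr_gt1 _ 2) // ltW.
Qed.

Lemma is_derive_dist_of_cos x :
  proper_cosine x -> is_derive x 1 (dist_of_cos lam) (- lam / lsine x).
Proof.
move=> hx; have [l1|lN] := hlam.
  rewrite (_ : dist_of_cos lam = @acos R); last first.
    by apply/funext => y; rewrite /dist_of_cos l1 eqxx.
  apply: (is_derive_eq (is_derive1_acos (proper_cosine1 l1 hx))).
  by rewrite /lsine l1 mul1r mulN1r.
rewrite (_ : dist_of_cos lam = @acosh R); last first.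
  by apply/funext => y; rewrite /dist_of_cos lN N1.
apply: (is_derive_eq (is_derive_acosh (proper_cosineN1 lN hx))).
by rewrite /lsine lN opprK mul1r mulN1r opprB.
Qed.

Lemma cosh0 : cosh 0 = 1 :> R.
Proof. by rewrite /cosh oppr0 expR0; lra. Qed.

Lemma sinh0 : sinh 0 = 0 :> R.
Proof. by rewrite /sinh oppr0 expR0 subrr mul0r. Qed.

Lemma cosh_sinh_acosh x : 1 < x ->
  cosh (acosh x) = x /\ sinh (acosh x) = Num.sqrt (x ^+ 2 - 1).
Proof.
move=> x1; have x0 : 0 < x by lra.
have s0 : 0 < x ^+ 2 - 1 by rewrite subr_gt0 expr_gt1 // ltW.
have s1 : 0 < Num.sqrt (x ^+ 2 - 1) by rewrite sqrtr_gt0.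
have xs0 : 0 < x + Num.sqrt (x ^+ 2 - 1) by rewrite addr_gt0.
have sE := sqr_sqrtr (ltW s0).
rewrite /cosh /sinh /acosh expRN lnK ?posrE //.
have -> : (x + Num.sqrt (x ^+ 2 - 1))^-1 = x - Num.sqrt (x ^+ 2 - 1).
  have xsN : x + Num.sqrt (x ^+ 2 - 1) != 0 by rewrite gt_eqF.
  by apply: (mulfI xsN); rewrite divff // mulrC -subr_sqr sE; ring.
by split; lra.
Qed.

Lemma lsin_lcos_dist x : proper_cosine x ->
  lsin lam (dist_of_cos lam x) = sqrtC lam%:C * (lsine x)%:C /\
  lcos lam (dist_of_cos lam x) = x%:C.
Proof.
move=> hx; rewrite /lsin /lcos /csin /ccos.
have [l1|lN] := hlam.
  have /andP[x1 x2] := proper_cosine1 l1 hx.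
  rewrite /dist_of_cos l1 eqxx rmorph1 sqrtC1 !mul1r /= cosh0 sinh0.
  rewrite !mulr0 !mulr1 sin_acos ?acosK ?in_itv /= ?(ltW x1) ?(ltW x2) //.
  by rewrite /lsine l1 mul1r oppr0.
have [cE sE] := cosh_sinh_acosh (proper_cosineN1 lN hx).
rewrite /dist_of_cos lN N1 rmorphN1 -imaginaryCE -complexiE.
rewrite /= !mul0r !mulr0 !mul1r !subr0 !add0r sin0 cos0 cE sE.
rewrite !mul0r !mul1r oppr0.
split=> //; rewrite /lsine lN mulN1r opprB.
by apply/eqP; rewrite eq_complex /= !mul0r !mul1r subrr add0r !eqxx.
Qed.

End DistOfCos.

(** * Varying one angle *)

Section SetAngle.
Variable R : realType.
Implicit Types (a : 'I_4 -> 'I_4 -> R) (i j r s : 'I_4) (t : R).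

Lemma set_angle_symm a r s t : symm a -> symm (set_angle a r s t).
Proof.
move=> aC i j; rewrite /set_angle aC; congr (if _ then _ else _).
by rewrite orbC (andbC (j == s)) (andbC (j == r)).
Qed.

Lemma set_angleC a r s t : set_angle a r s t = set_angle a s r t.
Proof. by apply/funext => i; apply/funext => j; rewrite /set_angle orbC. Qed.

Lemma set_angle_id a r s : symm a -> set_angle a r s (a r s) = a.
Proof.
move=> aC; apply/funext => i; apply/funext => j; rewrite /set_angle.
by case: ifP => // /orP[]/andP[/eqP-> /eqP->].
Qed.

(** The derivative of face_gram in the angle at r s: the only entry that moves
is the one opposite to r s. *)
Definition dface (a : 'I_4 -> 'I_4 -> R) r s : 'I_4 -> 'I_4 -> R :=
  fun k l => if uniq [:: r; s; k; l] then sin (a r s) else 0.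

Lemma dface_symm a r s : symm (dface a r s).
Proof.
move=> k l; rewrite /dface; congr (if _ then _ else _).
by apply/idP/idP => U; perm4 U.
Qed.

Lemma is_derive_face_gram a r s k l : symm a -> r != s ->
  is_derive (a r s) 1 (fun t => face_gram (set_angle a r s t) k l)
    (dface a r s k l).
Proof.
move=> aC rs; rewrite /dface; have [->|kl] := eqVneq k l.
  rewrite (_ : (fun t => _) = cst 1); last first.
    by apply/funext => t; rewrite face_gram_diag.
  by rewrite /= !inE eqxx /= !andbF; exact: is_derive_cst.
have [i [j U]] := ord4_complement kl.
have -> : uniq [:: r; s; k; l]
    = ((i == r) && (j == s)) || ((i == s) && (j == r)).
  apply/idP/orP => [U'|[]/andP[/eqP <- /eqP <-]]; [|by []|by perm4 U].
  have V : uniq [:: k; l; r; s] by perm4 U'.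
  have V' : uniq [:: k; l; i; j] by perm4 U.
  have [[-> ->]|[-> ->]] := ord4_complement_uniq V V'; [left|right];
    by rewrite !eqxx.
rewrite (_ : (fun t => _) = fun t => - cos (set_angle a r s t i j)); last first.
  by apply/funext => t; rewrite (face_gramE (set_angle_symm r s t aC) U).
rewrite /set_angle; case: ifP => _.
  by apply: (is_derive_eq (is_deriveN (is_derive_cos _))); rewrite opprK.
exact: is_derive_cst.
Qed.

Lemma is_derive_continuous (f : R -> R) (x d : R) :
  is_derive x 1 f d -> {for x, continuous f}.
Proof. by move=> [/derivable1_diffP/differentiable_continuous]. Qed.

Lemma near_gt0 (f : R -> R) (x d : R) : is_derive x 1 f d -> 0 < f x ->
  \forall t \near x, 0 < f t.
Proof. by move=> /is_derive_continuous fc f0; apply: cvgr_gt fc _ f0. Qed.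

End SetAngle.

Section NearRealizable.
Variables (R : realType) (lam : R).
Hypothesis hlam : lam = 1 \/ lam = -1.
Variables (a : 'I_4 -> 'I_4 -> R).
Hypothesis ha : realizable lam a.
Variables r s : 'I_4.
Hypothesis rs : r != s.

Let aC : symm a. Proof. by have [] := ha. Qed.

Let h t := face_gram (set_angle a r s t).

(** Near a the determinant is controlled through Jacobi's identity, as its
product with the positive 1 - h_ij^2 is a polynomial in the other minors. *)
Lemma near_realizable :
  \forall t \near a r s, realizable lam (set_angle a r s t).
Proof.
have dh i j : is_derive (a r s) 1 (fun t => h t i j) (dface a r s i j).
  exact: is_derive_face_gram.
have h0 : h (a r s) = face_gram a by rewrite /h set_angle_id.
have [_ ar af] := ha.
have angles : \forall t \near a r s,
    forall i j, i != j -> 0 < set_angle a r s t i j < pi.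
  have /andP[a0 api] := ar _ _ rs.
  near=> t; move=> i j ij; rewrite /set_angle; case: ifP => _; last exact: ar.
  by apply/andP; split; near: t; [exact: lt_nbhsr|exact: lt_nbhsl].
have minors i j k l : uniq [:: i; j; k; l] -> \forall t \near a r s,
    [/\ 0 < tri (h t) i j k,
        0 < lam * (tri (h t) i j k * tri (h t) i j l - cof (h t) i j k l ^+ 2)
      & lam = -1 -> 0 < cof (h t) i j k l].
  move=> U; have [tl D0 ckl] := af _ _ _ _ U.
  have kl : 0 < 1 - face_gram a i j ^+ 2.
    apply: (@one_sub_face_gram_sqr _ a k l); rewrite ?ar //; first last.
      by perm4 U.
    by apply: (@uniq4_neq k l i j); perm4 U.
  have d1 := is_derive_tri dh i j k; have d2 := is_derive_tri dh i j l.
  have d3 := is_derive_cof dh i j k l.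
  have d4 := is_deriveM (is_derive_cst lam (a r s) (1 : R))
    (is_deriveB (is_deriveM d1 d2) (is_deriveM d3 d3)).
  have n1 : \forall t \near a r s, 0 < tri (h t) i j k.
    by apply: near_gt0 d1 _; rewrite h0.
  have n2 : \forall t \near a r s,
     0 < lam * (tri (h t) i j k * tri (h t) i j l - cof (h t) i j k l ^+ 2).
    apply: near_gt0 d4 _; rewrite !fctE h0 -expr2 jacobi mulrA.
    exact: mulr_gt0.
  have [lN|lN] := eqVneq lam (-1); last first.
    near=> t; split; [by near: t|by near: t|].
    by move/eqP; rewrite (negPf lN).
  have n3 : \forall t \near a r s, 0 < cof (h t) i j k l.
    by apply: near_gt0 d3 _; rewrite h0 ckl.
  by near=> t; split; [near: t|near: t|move=> _; near: t].
pose P (e : 'I_4 * 'I_4 * ('I_4 * 'I_4)) t :=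
  uniq [:: e.1.1; e.1.2; e.2.1; e.2.2] ->
  [/\ 0 < tri (h t) e.1.1 e.1.2 e.2.1,
      0 < lam * (tri (h t) e.1.1 e.1.2 e.2.1 * tri (h t) e.1.1 e.1.2 e.2.2
                 - cof (h t) e.1.1 e.1.2 e.2.1 e.2.2 ^+ 2)
    & lam = -1 -> 0 < cof (h t) e.1.1 e.1.2 e.2.1 e.2.2].
have {}minors : \forall t \near a r s, forall e, P e t.
  have FF : Filter (nbhs (a r s)) by exact: nbhs_filter.
  refine (@filter_forall _ _ P _ FF _) => e; rewrite /P.
  have [U|U] := boolP (uniq [:: e.1.1; e.1.2; e.2.1; e.2.2]).
    by apply: filterS (minors _ _ _ _ U).
  by near=> t => U'; case/negP: U.
near=> t; have tC : symm (set_angle a r s t) by exact: set_angle_symm.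
have at_ : forall i j, i != j -> 0 < set_angle a r s t i j < pi by near: t.
split=> // i j k l U f.
have Pt : forall e, P e t by near: t.
have [t1 t2 t3] := Pt ((i, j), (k, l)) U; split => //.
move: t2; rewrite jacobi mulrA pmulr_lgt0 //.
apply: (@one_sub_face_gram_sqr _ _ k l) => //; last by perm4 U.
by apply/at_/(@uniq4_neq k l i j); perm4 U.
Unshelve. all: by end_near.
Qed.

End NearRealizable.

(** * The partial derivatives *)

Section Lengths.
Variables (R : realType) (lam : R).
Hypothesis hlam : lam = 1 \/ lam = -1.
Variables (V : 'M[R]_4) (a : 'I_4 -> 'I_4 -> R).
Hypotheses (hV : tetrahedron lam V) (ha : has_dihedral_angles lam V a).
Let c := cgram lam V.
Let f := face_gram a.
Let S i j := lsine lam (c i j).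
Let cC : symm c := cgramC lam V.
Let aC : symm a := angle_symm hlam hV ha.
Let fC : symm f := face_gramC aC.
Let cE : c = dual f := cgram_face_gram hlam hV ha.
Let hr : realizable lam a := angles_realizable hlam hV ha.

Lemma proper_cgram i j k l : uniq [:: i; j; k; l] -> proper_cosine lam (c i j).
Proof. by have [_ _ cg] := tetrahedron_gram hlam hV; move=> /cg[]. Qed.

Section Quadruple.
Variables i j k l : 'I_4.
Hypothesis U : uniq [:: i; j; k; l].
Let si := Num.sqrt (tri f j k l).
Let sj := Num.sqrt (tri f i k l).
Let sk := Num.sqrt (tri f i j l).
Let sl := Num.sqrt (tri f i j k).
Let D := det4 f i j k l.
Let sg := Num.sqrt (lam * D).

Lemma tri_face_gt0 :
  [/\ 0 < tri f j k l, 0 < tri f i k l, 0 < tri f i j l & 0 < tri f i j k].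
Proof.
have [_ _ hf] := hr; have [tl _ _] := hf _ _ _ _ U.
have [|ti _ _] := hf j k l i; first by perm4 U.
have [|tj _ _] := hf i k l j; first by perm4 U.
by have [|tk _ _] := hf i j l k; first by perm4 U.
Qed.

Lemma det4_face_gt0 : 0 < lam * D.
Proof. by have [_ _ hf] := hr; have [_ D0 _] := hf _ _ _ _ U. Qed.

Lemma is_derive_length r s : r != s ->
  is_derive (a r s) 1 (length_along lam a i j r s)
   (lam / (S i j * D)
    * ((1 - c i j ^+ 2)
       * (si * sj * dface a r s i j + si * sk * c j k * dface a r s i k
          + si * sl * c j l * dface a r s i l
          + sj * sk * c i k * dface a r s j k
          + sj * sl * c i l * dface a r s j l)
       + wnum c i j k l * (sk * sl * dface a r s k l))).
Proof.
move=> rs; pose h t := face_gram (set_angle a r s t).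
have h0 : h (a r s) = f by rewrite /h set_angle_id.
have hC t : symm (h t) by apply: face_gramC; exact: set_angle_symm.
have dh m n : is_derive (a r s) 1 (fun t => h t m n) (dface a r s m n).
  exact: is_derive_face_gram.
have [ti tj tk tl] := tri_face_gt0.
have DN : D != 0 by apply: contraTneq det4_face_gt0 => ->; rewrite mulr0 ltxx.
have := is_derive_dual hC (dface_symm a r s) dh U.
rewrite h0 -cE => /(_ ti tj tk tl DN) dd.
have da : is_derive (dual (h (a r s)) i j) 1 (dist_of_cos lam) (- lam / S i j).
  by rewrite h0 -cE; apply: (is_derive_dist_of_cos hlam); exact: proper_cgram U.
apply: (@near_eq_is_derive _ _ _
  (dist_of_cos lam \o (fun t => dual (h t) i j))).
  near=> t.
  have rt : realizable lam (set_angle a r s t).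
    by near: t; exact: near_realizable.
  by rewrite /length_along (length_of_anglesE hlam i j rt).
apply: (is_derive_eq (is_derive1_comp da dd)).
rewrite -/si -/sj -/sk -/sl -/D -/(wnum c i j k l).
by rewrite mulf_div mulrNN [RHS]mulrAC.
Unshelve. all: by end_near.
Qed.

(** The sine law, in the form where the right-hand side only depends on the
edge through S i j and the normalizing factors of its two ends. *)
Lemma sin_angle : sin (a i j) = si * sj * S i j / sg.
Proof.
have [ti tj tk tl] := tri_face_gt0.
have D0 := det4_face_gt0.
have U' : uniq [:: k; l; i; j] by perm4 U.
have [_ har _] := hr.
have /andP[a0 api] : 0 < a i j < pi by exact/har/uniq4_neq/U.
have [m0 _] := proper_cgram U.
have := @one_sub_dual_sqr _ f fC k l i j U'.
rewrite !(tri_rot fC k l) -(tri_rot fC i j l) -(tri_rot fC i j k).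
rewrite -(det4C13_24 fC i j k l) -cE => /(_ tk tl ti tj).
have sij0 : 0 < si * sj by rewrite mulr_gt0 ?sqrtr_gt0.
have sijN : (si * sj) ^+ 2 != 0 by rewrite expf_neq0 // gt_eqF.
have DN : D != 0 by apply: contraTneq D0 => ->; rewrite mulr0 ltxx.
have fE : f k l = - cos (a i j) by rewrite /f (face_gramE aC U).
rewrite fE sqrrN -sin2cos2 => E.
have S2 : S i j ^+ 2 = lam * D * sin (a i j) ^+ 2 / (si * sj) ^+ 2.
  by rewrite sqr_sqrtr ?ltW // E !mulrA.
have sE : sin (a i j) ^+ 2 = (si * sj * S i j / sg) ^+ 2.
  rewrite expr_div_n exprMn S2 sqr_sqrtr ?ltW //.
  by rewrite [_ * (_ / _)]mulrC divfK // mulrC mulKf // gt_eqF.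
have s0 : 0 <= sin (a i j) by rewrite ltW // sin_gt0_pi // a0.
have r0 : 0 <= si * sj * S i j / sg by rewrite divr_ge0 ?mulr_ge0 ?sqrtr_ge0.
by apply/eqP; rewrite -(@eqrXn2 _ 2) // sE.
Qed.

End Quadruple.

(** The factor common to all partial derivatives, that is, R^{ij}_{kl}. *)
Definition rho i j k l := (Num.sqrt (lam * det4 c i j k l))^-1.

Section Partials.
Variables i j k l : 'I_4.
Hypothesis U : uniq [:: i; j; k; l].
Let si := Num.sqrt (tri f j k l).
Let sj := Num.sqrt (tri f i k l).
Let sk := Num.sqrt (tri f i j l).
Let sl := Num.sqrt (tri f i j k).
Let D := det4 f i j k l.
Let sg := Num.sqrt (lam * D).

(** By det4_dual, det c is the cube of det h over the squared product of the
normalizing factors. *)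
Lemma rhoE : rho i j k l = si * sj * sk * sl / sg ^+ 3.
Proof.
have [ti tj tk tl] := tri_face_gt0 U.
have D0 := det4_face_gt0 U.
have P0 : 0 < si * sj * sk * sl by rewrite !mulr_gt0 ?sqrtr_gt0.
have sg0 : 0 < sg by rewrite sqrtr_gt0.
have sg2 : sg ^+ 2 = lam * D by rewrite sqr_sqrtr // ltW.
rewrite /rho cE (det4_dual fC U) // -/si -/sj -/sk -/sl -/D.
rewrite (_ : lam * _ = (sg ^+ 3 / (si * sj * sk * sl)) ^+ 2).
  by rewrite sqrtr_sqr gtr0_norm ?divr_gt0 ?exprn_gt0 // invf_div.
rewrite expr_div_n mulrA -exprM mulnC exprM sg2 exprMn; congr (_ / _).
by rewrite exprMn (exprS lam 2) (sqr_lam hlam) mulr1.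
Qed.

Lemma partials :
  [/\ is_derive (a i j) 1 (length_along lam a i j i j)
        (rho i j k l * wnum c i j k l),
      is_derive (a i k) 1 (length_along lam a i j i k)
        (rho i j k l * (lam * (S i j * S i k)) * c i l)
    & is_derive (a k l) 1 (length_along lam a i j k l)
        (rho i j k l * (lam * (S i j * S k l)))].
Proof.
have U1 : uniq [:: i; k; j; l] by perm4 U.
have U2 : uniq [:: k; l; i; j] by perm4 U.
have [ij ik kl] : [/\ i != j, i != k & k != l].
  move: U; rewrite /= !inE !negb_or -!andbA.
  by move=> /and5P[-> -> _ _ /andP[_ /andP[-> _]]].
have [m0 _] := proper_cgram U.
have sg0 : 0 < sg by rewrite sqrtr_gt0 det4_face_gt0.
have DE : D = lam * sg ^+ 2.
  by rewrite sqr_sqrtr ?ltW ?det4_face_gt0 // mulrA -expr2 (sqr_lam hlam) mul1r.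
have mE : 1 - c i j ^+ 2 = lam * S i j ^+ 2.
  by rewrite sqr_sqrtr ?ltW // mulrA -expr2 (sqr_lam hlam) mul1r.
have S0 : 0 < S i j by rewrite sqrtr_gt0.
have sgN : sg != 0 by rewrite gt_eqF.
have SN : S i j != 0 by rewrite gt_eqF.
have lN : lam != 0 by case: hlam => ->; rewrite ?oppr_eq0 oner_eq0.
have sin_ij := sin_angle U.
have sin_ik : sin (a i k) = si * sk * S i k / sg.
  by rewrite (sin_angle U1) (triC12 fC k j l) -(det4C23 fC i j k l).
have sin_kl : sin (a k l) = sk * sl * S k l / sg.
  rewrite (sin_angle U2) -(tri_rot fC i j l) -(tri_rot fC i j k).
  by rewrite -(det4C13_24 fC i j k l).
rewrite -/si -/sj -/sg in sin_ij.
split.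
- apply: (is_derive_eq (is_derive_length U ij)).
  rewrite -/si -/sj -/sk -/sl -/D /dface U /= !inE !eqxx /= ?(orbT, andbF) /=.
  rewrite !mulr0 !addr0 mulr0 add0r rhoE DE sin_ij.
  move: sgN SN lN.
  generalize (wnum c i j k l) si sj sk sl sg (S i j) lam => *.
  by field; do ?[apply/andP; split].
- apply: (is_derive_eq (is_derive_length U ik)).
  rewrite -/si -/sj -/sk -/sl -/D /dface U1 /= !inE !eqxx /= ?(orbT, andbF) /=.
  rewrite !mulr0 !addr0 !add0r rhoE mE DE sin_ik.
  move: sgN SN lN.
  generalize (c i l) (S i k) si sj sk sl sg (S i j) lam => *.
  by field; do ?[apply/andP; split].
- apply: (is_derive_eq (is_derive_length U kl)).
  rewrite -/si -/sj -/sk -/sl -/D /dface U2 /= !inE !eqxx /= ?(orbT, andbF) /=.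
  rewrite !mulr0 !addr0 rhoE mE DE sin_kl.
  move: sgN SN lN.
  generalize (S k l) si sj sk sl sg (S i j) lam => *.
  by field; do ?[apply/andP; split].
Qed.

End Partials.

End Lengths.

(** * The coefficients *)

(** Up to exchanging the ends of each edge, two edges are equal, share their
first end, or are opposite. *)
Lemma edge_pair_ind (P : 'I_4 -> 'I_4 -> 'I_4 -> 'I_4 -> Prop) :
  (forall i j r s, P i j r s -> P j i r s) ->
  (forall i j r s, P i j r s -> P i j s r) ->
  (forall i j, i != j -> P i j i j) ->
  (forall i j k l, uniq [:: i; j; k; l] -> P i j i k) ->
  (forall i j k l, uniq [:: i; j; k; l] -> P i j k l) ->
  forall i j r s, i != j -> r != s -> P i j r s.
Proof.
move=> sw1 sw2 same adj opp i j r s ij rs.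
have [k [l U]] := ord4_complement ij.
have U1 : uniq [:: i; j; k; l] by perm4 U.
have U2 : uniq [:: i; j; l; k] by perm4 U.
have U3 : uniq [:: j; i; k; l] by perm4 U.
have U4 : uniq [:: j; i; l; k] by perm4 U.
have /[!inE] := ord4_cover r U1; have /[!inE] := ord4_cover s U1.
move=> /or4P[]/eqP es /or4P[]/eqP er; rewrite es er ?eqxx // in rs *.
- exact/sw2/same.
- by apply/sw2/adj; exact: U1.
- by apply/sw2/adj; exact: U2.
- exact: same.
- by apply/sw1/sw2/adj; exact: U3.
- by apply/sw1/sw2/adj; exact: U4.
- by apply: adj; exact: U1.
- by apply/sw1/adj; exact: U3.
- by apply: opp; exact: U2.
- by apply: adj; exact: U2.
- by apply/sw1/adj; exact: U4.
- by apply: opp; exact: U1.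
Qed.

Section EdgePairs.
Variables (T : Type) (Q : 'I_4 -> 'I_4 -> 'I_4 -> 'I_4 -> T).
Hypotheses (QCl : forall i j r s, Q i j r s = Q j i r s)
           (QCr : forall i j r s, Q i j r s = Q i j s r).

Lemma edge_pair_symmetric :
  (forall i j k l, uniq [:: i; j; k; l] -> Q i j i k = Q i k i j) ->
  (forall i j k l, uniq [:: i; j; k; l] -> Q i j k l = Q k l i j) ->
  forall i j r s, i != j -> r != s -> Q i j r s = Q r s i j.
Proof.
move=> adj opp.
apply: (@edge_pair_ind (fun i j r s => Q i j r s = Q r s i j)) => //.
- by move=> i j r s E; rewrite QCl E QCr.
- by move=> i j r s E; rewrite QCr E QCl.
Qed.

Lemma edge_pair_complement :
  (forall i j k l, uniq [:: i; j; k; l] -> Q i j i k = Q l k l j) ->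
  (forall i j k l, uniq [:: i; j; k; l] -> Q i j k l = Q k l i j) ->
  forall i j r s i' j' r' s',
  uniq [:: i; j; i'; j'] -> uniq [:: r; s; r'; s'] ->
  [set i; j]%SET != [set r; s]%SET -> Q i j r s = Q i' j' r' s'.
Proof.
move=> adj opp i j r s i' j' r' s' U U'.
have ij := uniq4_neq U; have rs := uniq4_neq U'.
move: i j r s ij rs i' j' r' s' U U'.
apply: (@edge_pair_ind (fun i j r s => forall i' j' r' s',
  uniq [:: i; j; i'; j'] -> uniq [:: r; s; r'; s'] ->
  [set i; j]%SET != [set r; s]%SET -> Q i j r s = Q i' j' r' s')).
- move=> i j r s E i' j' r' s' U U' ne; rewrite QCl; apply: E => //.
    by perm4 U.
  by rewrite finset.setUC.
- move=> i j r s E i' j' r' s' U U' ne; rewrite QCr; apply: E => //.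
    by perm4 U'.
  by rewrite (finset.setUC [set r]%SET).
- by move=> i j ij i' j' r' s' _ _; rewrite eqxx.
- move=> i j k l U i' j' r' s' U1 U2 _.
  have U3 : uniq [:: i; k; j; l] by perm4 U.
  rewrite (adj _ _ _ _ U).
  have [[-> ->]|[-> ->]] := ord4_complement_uniq U U1;
  have [[-> ->]|[-> ->]] := ord4_complement_uniq U3 U2.
  - by rewrite QCl QCr.
  - by rewrite QCl.
  - by rewrite QCr.
  - by [].
- move=> i j k l U i' j' r' s' U1 U2 _.
  have U3 : uniq [:: k; l; i; j] by perm4 U.
  rewrite (opp _ _ _ _ U).
  have [[-> ->]|[-> ->]] := ord4_complement_uniq U U1;
  have [[-> ->]|[-> ->]] := ord4_complement_uniq U3 U2.
  - by [].
  - by rewrite QCr.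
  - by rewrite QCl.
  - by rewrite QCl QCr.
Qed.

End EdgePairs.

Section Coefficients.
Local Open Scope complex_scope.
Variables (R : realType) (lam : R).
Hypothesis hlam : lam = 1 \/ lam = -1.
Variables (V : 'M[R]_4) (a : 'I_4 -> 'I_4 -> R).
Hypotheses (hV : tetrahedron lam V) (ha : has_dihedral_angles lam V a).
Let c := cgram lam V.
Let S i j := lsine lam (c i j).
Let cC : symm c := cgramC lam V.
Let aC : symm a := angle_symm hlam hV ha.
Local Notation Rc := (Rcoef lam V a).
Local Notation rho := (rho lam V).

Lemma edge_lengthC W i j : edge_length lam W i j = edge_length lam W j i.
Proof. by rewrite /edge_length /gdist bformC. Qed.

Lemma RcoefCl i j r s : Rc i j r s = Rc j i r s.
Proof.
rewrite /Rcoef edge_lengthC /dlength.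
rewrite (_ : length_along _ _ _ _ _ _ = length_along lam a j i r s) //.
by apply/funext => t; exact: edge_lengthC.
Qed.

Lemma RcoefCr i j r s : Rc i j r s = Rc i j s r.
Proof.
rewrite /Rcoef (edge_lengthC V r) /dlength (aC r).
rewrite (_ : length_along _ _ _ _ _ _ = length_along lam a i j s r) //.
by apply/funext => t; rewrite /length_along set_angleC.
Qed.

Lemma lsin_edge i j : i != j ->
  lsin lam (edge_length lam V i j) = sqrtC lam%:C * (S i j)%:C.
Proof.
move=> ij; have [k [l U]] := ord4_complement ij.
have {}U : uniq [:: i; j; k; l] by perm4 U.
rewrite edge_lengthE //.
by have [-> _] := lsin_lcos_dist hlam (proper_cgram hlam hV U).
Qed.

Lemma lcos_edge i j : i != j -> lcos lam (edge_length lam V i j) = (c i j)%:C.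
Proof.
move=> ij; have [k [l U]] := ord4_complement ij.
have {}U : uniq [:: i; j; k; l] by perm4 U.
rewrite edge_lengthE //.
by have [_ ->] := lsin_lcos_dist hlam (proper_cgram hlam hV U).
Qed.

Lemma RcoefE i j r s d : i != j -> r != s ->
  is_derive (a r s) 1 (length_along lam a i j r s) d ->
  Rc i j r s = ((lam * (S i j * S r s))^-1 * d)%:C.
Proof.
move=> ij rs dd; rewrite /Rcoef !lsin_edge // /dlength derive1E derive_val.
by rewrite mulrACA -expr2 sqrtCK -!rmorphM -fmorphV -rmorphM.
Qed.

Section Quadruple.
Variables i j k l : 'I_4.
Hypothesis U : uniq [:: i; j; k; l].

Let neqs : [/\ i != j, i != k, i != l & [/\ j != k, j != l & k != l]].
Proof.
move: U; rewrite /= !inE !negb_or -!andbA.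
by move=> /and5P[-> -> -> -> /and3P[-> -> _]].
Qed.

Lemma rhoC12 : rho i j k l = rho j i k l.
Proof. by rewrite /rho det4C12. Qed.
Lemma rhoC23 : rho i j k l = rho i k j l.
Proof. by rewrite /rho det4C23. Qed.
Lemma rhoC34 : rho i j k l = rho i j l k.
Proof. by rewrite /rho det4C34. Qed.

Let Sneq0 m n : m != n -> S m n != 0.
Proof.
move=> mn; have [m' [n' U']] := ord4_complement mn.
have {}U' : uniq [:: m; n; m'; n'] by perm4 U'.
by have [p _] := proper_cgram hlam hV U'; rewrite gt_eqF // sqrtr_gt0.
Qed.

Let lsine_sqr : lam * S i j ^+ 2 = 1 - c i j ^+ 2.
Proof.
have [p _] := proper_cgram hlam hV U.
by rewrite sqr_sqrtr ?ltW // mulrA -expr2 (sqr_lam hlam) mul1r.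
Qed.

Let lam0 : lam != 0.
Proof. by case: hlam => ->; rewrite ?oppr_eq0 oner_eq0. Qed.

Lemma Rcoef_opposite : Rc i j k l = (rho i j k l)%:C.
Proof.
have [ij ik il [jk jl kl]] := neqs.
have [_ _ d] := partials hlam hV ha U.
rewrite (RcoefE ij kl d) -/c -/(S i j) -/(S k l) mulrC mulfK //.
by rewrite !mulf_neq0 ?Sneq0.
Qed.

Lemma Rcoef_adjacent : Rc i j i k = (rho i j k l * c i l)%:C.
Proof.
have [ij ik il [jk jl kl]] := neqs.
have [_ d _] := partials hlam hV ha U.
rewrite (RcoefE ij ik d) -/c -/(S i j) -/(S i k) mulrC mulrAC mulfK //.
by rewrite !mulf_neq0 ?Sneq0.
Qed.

Lemma Rcoef_same :
  Rc i j i j = (rho i j k l * (wnum c i j k l / (1 - c i j ^+ 2)))%:C.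
Proof.
have [ij ik il [jk jl kl]] := neqs.
have [d _ _] := partials hlam hV ha U.
by rewrite (RcoefE ij ij d) -/c -/(S i j) -expr2 lsine_sqr mulrC -mulrA.
Qed.

Lemma wcoefE : wcoef lam V i j k l = (wnum c i j k l / (1 - c i j ^+ 2))%:C.
Proof.
have [ij ik il [jk jl kl]] := neqs.
have ji : j != i by rewrite eq_sym.
rewrite /wcoef /ccoef !lcos_edge // lsin_edge // exprMn sqrtCK.
rewrite -!(rmorphM, rmorphN, rmorphD, rmorphB, rmorphXn, fmorphV) /=.
rewrite lsine_sqr; congr ((_ / _)%:C); rewrite /wnum (cC j i).
move: (c i j) (c i k) (c i l) (c j k) (c j l) => *; ring.
Qed.

End Quadruple.

Lemma Rcoef_opposite_swap i j k l :
  uniq [:: i; j; k; l] -> Rc i j k l = Rc k l i j.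
Proof.
move=> U; have U' : uniq [:: k; l; i; j] by perm4 U.
apply: etrans (Rcoef_opposite U) _; apply: etrans _ (esym (Rcoef_opposite U')).
by rewrite /rho det4C13_24.
Qed.

Lemma RcoefC i j r s : i != j -> r != s -> Rc i j r s = Rc r s i j.
Proof.
apply: (edge_pair_symmetric RcoefCl RcoefCr) => {}i {}j k l U.
  have U' : uniq [:: i; k; j; l] by perm4 U.
  apply: etrans (Rcoef_adjacent U) _.
  apply: etrans _ (esym (Rcoef_adjacent U')).
  by rewrite rhoC23.
exact: Rcoef_opposite_swap.
Qed.

Lemma Rcoef_complement i j r s i' j' r' s' :
  uniq [:: i; j; i'; j'] -> uniq [:: r; s; r'; s'] ->
  [set i; j]%SET != [set r; s]%SET -> Rc i j r s = Rc i' j' r' s'.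
Proof.
apply: (edge_pair_complement RcoefCl RcoefCr) => {}i {}j k l U.
  have U' : uniq [:: l; k; j; i] by perm4 U.
  apply: etrans (Rcoef_adjacent U) _.
  apply: etrans _ (esym (Rcoef_adjacent U')).
  by rewrite (cC i) rhoC12 rhoC23 rhoC34 rhoC12 rhoC23 rhoC12.
exact: Rcoef_opposite_swap.
Qed.

End Coefficients.

Theorem theorem2p2 (R : realType) (lam : R) (hlam : lam = 1 \/ lam = -1)
    (V : 'M[R]_4) (hV : tetrahedron lam V)
    (a : 'I_4 -> 'I_4 -> R) (ha : has_dihedral_angles lam V a) :
  (* the partial derivatives exist *)
  (forall i j r s : 'I_4, i != j -> r != s ->
     derivable (length_along lam a i j r s) (a r s) 1) /\
  (* (i) *)
  (forall i j r s : 'I_4, i != j -> r != s ->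
     Rcoef lam V a i j r s = Rcoef lam V a r s i j) /\
  (* (ii) *)
  (forall i j k l : 'I_4, uniq [:: i; j; k; l] ->
     Rcoef lam V a i j k l = Rcoef lam V a i k j l /\
     Rcoef lam V a i k j l = Rcoef lam V a i l j k) /\
  (* (iii) *)
  (forall i j k l : 'I_4, uniq [:: i; j; k; l] ->
     Rcoef lam V a i j i k
     = Rcoef lam V a i j k l * lcos lam (edge_length lam V i l)) /\
  (* (iv) *)
  (forall i j k l : 'I_4, uniq [:: i; j; k; l] ->
     Rcoef lam V a i j i j
     = Rcoef lam V a i j k l * wcoef lam V i j k l) /\
  (* (v): {i',j'} and {r',s'} are the complements of {i,j} and {r,s} *)
  (forall i j i' j' r s r' s' : 'I_4,
     uniq [:: i; j; i'; j'] -> uniq [:: r; s; r'; s'] ->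
     [set i; j]%SET != [set r; s]%SET ->
     Rcoef lam V a i j r s = Rcoef lam V a i' j' r' s').
Proof.
split.
  move=> i j r s ij rs; have [k [l U]] := ord4_complement ij.
  have {}U : uniq [:: i; j; k; l] by perm4 U.
  by have [] := is_derive_length hlam hV ha U rs.
split; first exact: RcoefC.
have opposite := Rcoef_opposite hlam hV ha.
split.
  move=> i j k l U.
  have U1 : uniq [:: i; k; j; l] by perm4 U.
  have U2 : uniq [:: i; l; j; k] by perm4 U.
  split.
    apply: etrans (opposite _ _ _ _ U) _.
    apply: etrans _ (esym (opposite _ _ _ _ U1)).
    by rewrite rhoC23.
  apply: etrans (opposite _ _ _ _ U1) _.
  apply: etrans _ (esym (opposite _ _ _ _ U2)).
  by rewrite rhoC34 rhoC23 rhoC34.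
split.
  move=> i j k l U.
  have il : i != l.
    by move: U; rewrite /= !inE !negb_or => /andP[/and3P[]].
  apply: etrans (Rcoef_adjacent hlam hV ha U) _.
  by rewrite lcos_edge // rmorphM; congr (_ * _); exact/esym/opposite.
split.
  move=> i j k l U; apply: etrans (Rcoef_same hlam hV ha U) _.
  by rewrite (wcoefE hlam hV U) rmorphM; congr (_ * _); exact/esym/opposite.
move=> i j i' j' r s r' s' U U'.
exact: (Rcoef_complement hlam hV ha U U').
Qed.
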